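(* Let $(\Gamma,G,\Lambda)$ be a splitting crystal triple in $\mathbb{R}^d$, $G=\{g_1=\mathrm{Id},\dots,g_r\}$, let $a$ be a $\Gamma$-admissible matrix, $m=|\det a|$, and let $\{\mathcal{V}_j\}_{j\in\mathbb{Z}}$ be a $(\Gamma,a)$-MRA for $L^2(\mathbb{R}^d)$ of multiplicity $1$ with crystal-scaling function $\phi$. Let $\psi^1,\dots,\psi^{m-1}\in\mathcal{V}_1$, put $\psi^0=\phi$, and let $\widetilde c_{l,k}$, $M_l$, $u_{lh}$, $\Psi_l$, $\mathcal{M}$, $\mathcal{U}$ and $\mathbb{V}_1$ be associated to $\psi^0,\dots,\psi^{m-1}$ as defined in the context. Let $\mathcal{W}_0=\mathcal{V}_1\ominus\mathcal{V}_0$ be the orthogonal complement of $\mathcal{V}_0$ in $\mathcal{V}_1$. Then the following statements are equivalent. (a) $\{D_\gamma\psi^l\}_{\gamma\in\Gamma,\ l=1,\dots,m-1}$ forms an orthonormal basis for $\mathcal{W}_0$. (b) $\mathcal{U}(\omega)$ is unitary for a.e. $\omega$, and the functions $\Psi_l$ associated to $\mathcal{U}$ belong to $\mathbb{V}_1$. (c) $\mathcal{M}(\omega)$ is unitary for a.e. $\omega$, and the functions $\Psi_l$ associated to $\mathcal{M}$ belong to $\mathbb{V}_1$. (d) $\frac1m\sum_{k\in\Lambda}\widetilde c_{i,k}\,\widetilde c_{j,k-av}^{\,*}=\delta_{0,v}\,\delta_{i,j}\,I_{r\times r}$ for all $v\in\Lambda$ and $i,j=0,\dots,m-1$, and the matrices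 $\widetilde c_{i,k}$ have $(\Gamma,a)$-symmetry.
   Context: A crystal group is a discrete subgroup $\Gamma$ of the isometry group of $\mathbb{R}^d$ admitting a compact fundamental domain. Then $\Lambda=\Gamma\cap\{\text{translations}\}$ consists of the translations by the vectors of a full rank lattice, also denoted $\Lambda$, and the point group $G\cong\Gamma/\Lambda$ (the linear parts of elements of $\Gamma$) is a finite subgroup of $O(d)$ with $g(\Lambda)=\Lambda$ for $g\in G$; $(\Gamma,G,\Lambda)$ is a crystal triple. It is splitting if $\Gamma=G\ltimes\Lambda$; then elements are $\gamma=(g,k)$, $g\in G$, $k\in\Lambda$, acting by $\gamma(x)=g(x+k)$. A matrix $a$ is $\Gamma$-admissible if all its eigenvalues have modulus larger than $1$ and $a\Gamma a^{-1}\subset\Gamma$. Standing assumption: $a$ admits a set of digits $\{d_0,\dots,d_{m-1}\}$ (representatives of $\Lambda/a\Lambda$) such that the unique compact set $\mathcal{Q}$ with $a(\mathcal{Q})=\bigcup_s(\mathcal{Q}+d_s)$ is a tiling of $\mathbb{R}^d$, i.e. $\{\mathcal{Q}+\lambda\}_{\lambda\in\Lambda}$ covers $\mathbb{R}^d$. It is also a standing assumption that only finitely many coefficients in refinement equations are non-zero. For an invertible affine map $\gamma$ with linear part $\mathrm{lin}(\gamma)$, $D_\gamma f(x)=|\det\mathrm{lin}(\gamma)|^{-1/2}f(\gamma^{-1}x)$. A $(\Gamma,a)$-MRA of multiplicity $n$ is a sequence $\{\mathcal{V}_j\}_{j\in\mathbb{Z}}$ of closed subspaces of $L^2(\mathbb{R}^d)$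 with: (i) $\mathcal{V}_j\subset\mathcal{V}_{j+1}$; (ii) $\mathcal{V}_{j+1}=D_a^{-1}\mathcal{V}_j$; (iii) $\bigcap_j\mathcal{V}_j=\{0\}$ and $\overline{\bigcup_j\mathcal{V}_j}=L^2(\mathbb{R}^d)$; (iv) there are $\phi_1,\dots,\phi_n\in L^2(\mathbb{R}^d)$ (the crystal-scaling function vector) such that $\{D_\gamma\phi_i:\gamma\in\Gamma,\ i=1,\dots,n\}$ is an orthonormal basis of $\mathcal{V}_0$. When $\Gamma$ is replaced by $\Lambda$ this is a (classical) MRA of multiplicity $n$ with scaling vector function $(\phi_1,\dots,\phi_n)$. $(\Gamma,a)$-symmetry: matrices $c_k=(c_{i,j}^k)\in\mathbb{C}^{r\times r}$, $k\in\Lambda$, have $(\Gamma,a)$-symmetry if $c_{i,j}^k=c_{1,\rho_i(j)}^{g_{h_i}^{-1}(k)}$ for all $i,j,k$, where $g_{h_i}=ag_ia^{-1}$ and $g_{\rho_i(j)}=g_{h_i}^{-1}g_j$. Put $\Phi=(\phi\circ g_1^{-1},\dots,\phi\circ g_r^{-1})^T$; it is the scaling vector function of $\{\mathcal{V}_j\}$ viewed as a classical MRA of multiplicity $r$, denoted $\{\widetilde V_j\}$. $\mathbb{V}_1$ is the set of vector functions $F$, with components in $\widetilde V_1=\mathcal{V}_1$, such that the matrices $c_k$ in $F(x)=\sum_{k\in\Lambda}c_k\Phi(ax-k)$ have $(\Gamma,a)$-symmetry. For $l=0,\dots,m-1$ write $\psi^l(x)=\sum_{\gamma\in\Gamma}c_\gamma^l\,\phi(\gamma^{-1}(ax))$,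 set $$\widetilde c_{l,k}=\left(c^l_{(g_{h_i}^{-1}g_j,\ g_j^{-1}(k))}\right)_{i,j=1,\dots,r},\qquad M_l(\omega)=\frac1m\sum_{k\in\Lambda}\widetilde c_{l,k}e^{-2\pi ik\cdot\omega},$$ and $\Psi_l=(D_{g_1}\psi^l,\dots,D_{g_r}\psi^l)^T$. Thus $\Psi_l(x)=\sum_{k\in\Lambda}\widetilde c_{l,k}\Phi(ax-k)$, equivalently $\widehat{\Psi}_l(a^*\omega)=M_l(\omega)\widehat\Phi(\omega)$, where $\widehat f(\omega)=\int f(x)e^{-2\pi ix\cdot\omega}dx$ and $a^*$ is the adjoint of $a$. For $h=0,\dots,m-1$ let $$u_{lh}(\omega)=\frac1{\sqrt m}\sum_{k\in\Lambda}\widetilde c_{l,ak+d_h}e^{-2\pi ik\cdot\omega}.$$ Define the $rm\times rm$ block matrices $$\mathcal{M}(\omega)=\left[M_i(\omega+(a^* )^{-1}\varrho_j)\right]_{i,j=0,\dots,m-1},\qquad \mathcal{U}(\omega)=\left[u_{lh}(\omega)\right]_{l,h=0,\dots,m-1},$$ where $\{\varrho_j\}_{j=0}^{m-1}$ is a complete set of representatives of $\Lambda^*/a^*\Lambda^*$ and $\Lambda^*=\{\xi\in\mathbb{R}^d:k\cdot\xi\in\mathbb{Z}\ \forall k\in\Lambda\}$ is the dual lattice. *)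

(* Defs.v *)
From HB Require Import structures.
From mathcomp Require Import all_boot all_order all_algebra.
From mathcomp Require Import all_classical all_reals all_analysis.
From mathcomp Require Import finmap.
From mathcomp Require Import complex.

Set Implicit Arguments.
Unset Strict Implicit.
Unset Printing Implicit Defensive.
Import Order.TTheory GRing.Theory Num.Theory.
Import numFieldNormedType.Exports.

Local Open Scope classical_set_scope.
Local Open Scope ring_scope.
Local Open Scope complex_scope.
Local Open Scope sesquilinear_scope.

(* ['cV[R]_n] models R^n.  The library has neither a sigma-algebra nor Lebesgue
   measure on it; the sigma-algebra generated by the coordinates is the Borel
   one. *)
Section measurable_cV.
Context {R : realType} (n : nat).

Definition cV_coord (i : 'I_n) (v : 'cV[R]_n) : R := v i ord0.

Let cV_set0 : g_sigma_preimage cV_coord set0.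
Proof. exact: sigma_algebra0. Qed.

Let cV_setC A : g_sigma_preimage cV_coord A -> g_sigma_preimage cV_coord (~` A).
Proof. exact: sigma_algebraC. Qed.

Let cV_bigcup (F : (set 'cV[R]_n)^nat) :
    (forall i, g_sigma_preimage cV_coord (F i)) ->
  g_sigma_preimage cV_coord (\bigcup_i F i).
Proof. exact: sigma_algebra_bigcup. Qed.

HB.instance Definition _ := @isMeasurable.Build default_measure_display
  'cV[R]_n (g_sigma_preimage cV_coord) cV_set0 cV_setC cV_bigcup.

End measurable_cV.

Section measurable_cV_theory.
Context {R : realType}.

Lemma measurable_cV_coord n (i : 'I_n) :
  measurable_fun [set: 'cV[R]_n] (fun v => v i ord0).
Proof.
move=> _ Y mY; rewrite setTI; apply: sub_sigma_algebra => /=.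
rewrite -bigcup_seq/=; exists i => /=; first by rewrite mem_index_enum.
by exists Y => //; rewrite setTI.
Qed.

Lemma measurable_fun_cVP d (T : measurableType d) n (f : T -> 'cV[R]_n) :
  measurable_fun [set: T] f <->
  forall i, measurable_fun [set: T] (fun x => f x i ord0).
Proof.
split=> [mf i|mf].
  exact: (measurableT_comp (measurable_cV_coord i) mf).
move=> _ A mA; rewrite setTI.
have : preimage_set_system [set: T] f measurable `<=` measurable.
  rewrite -[X in X `<=` _](g_sigma_preimage_comp (@cV_coord R n) f).
  apply: smallest_sub; first exact: sigma_algebra_measurable.
  case: n => [|n] in f mf {A mA} *; first by rewrite big_ord0.
  rewrite -bigcup_mkord_ord; apply: bigcup_sub => i Ii.
  by move=> _ [B mB <-]; exact: mf.
by apply; exists A => //; rewrite setTI.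
Qed.

Definition cV_cons n (p : R * 'cV[R]_n) : 'cV[R]_n.+1 :=
  col_mx (p.1%:M : 'cV_1) p.2.

Definition cV_uncons n (v : 'cV[R]_n.+1) : R * 'cV[R]_n :=
  (v ord0 ord0, @dsubmx R 1 n 1 v).

Lemma cV_consK n : cancel (@cV_cons n) (@cV_uncons n).
Proof.
move=> [x v]; rewrite /cV_uncons /cV_cons/= col_mxKd; congr (_, _).
have -> : (ord0 : 'I_n.+1) = lshift n (ord0 : 'I_1) by apply: val_inj.
by rewrite (@col_mxEu R 1 n 1) mxE eqxx.
Qed.

Lemma cV_unconsK n : cancel (@cV_uncons n) (@cV_cons n).
Proof.
move=> v; rewrite /cV_uncons /cV_cons/= -[RHS](@vsubmxK R 1 n 1 v).
rewrite (_ : (v _ _)%:M = @usubmx R 1 n 1 v)//.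
apply/matrixP => i j; rewrite !ord1 !mxE eqxx mulr1n.
by congr (v _ _); apply: val_inj.
Qed.

Lemma measurable_cV_cons n : measurable_fun [set: R * 'cV[R]_n] (@cV_cons n).
Proof.
apply/measurable_fun_cVP => i; rewrite /cV_cons.
have [j|j] := @split_ordP 1 n i.
  move=> ->; rewrite (_ : (fun _ => _) = fst); first exact: measurable_fst.
  by apply/funext => p; rewrite (@col_mxEu R 1 n 1) !ord1 mxE eqxx.
move=> ->.
rewrite (_ : (fun _ => _) = (fun v : 'cV_n => v j ord0) \o snd).
  exact: measurableT_comp (measurable_cV_coord j) measurable_snd.
by apply/funext => p; rewrite (@col_mxEd R 1 n 1).
Qed.

Lemma measurable_cV_uncons n : measurable_fun [set: 'cV[R]_n.+1] (@cV_uncons n).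
Proof.
apply/measurable_fun_pairP; split; first exact: measurable_cV_coord.
apply/measurable_fun_cVP => i.
rewrite (_ : (fun _ => _) = fun v : 'cV_n.+1 => v (@rshift 1 n i) ord0).
  exact: measurable_cV_coord.
by apply/funext => v /=; rewrite mxE.
Qed.

End measurable_cV_theory.

Section lebesgue_cV_step.
Local Open Scope ereal_scope.
Context {R : realType} (n : nat).
Variable mu : {sigma_finite_measure set 'cV[R]_n -> \bar R}.

Definition lebesgue_cV_step : set 'cV[R]_n.+1 -> \bar R :=
  pushforward (@lebesgue_measure R \x mu) (@cV_cons R n).

Let step0 : lebesgue_cV_step set0 = 0.
Proof. by rewrite /lebesgue_cV_step /pushforward preimage_set0 measure0. Qed.

Let step_ge0 A : 0 <= lebesgue_cV_step A.
Proof. by rewrite /lebesgue_cV_step /pushforward measure_ge0. Qed.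

Let step_sigma_additive : semi_sigma_additive lebesgue_cV_step.
Proof.
apply: (@measure_semi_sigma_additive _ _ _ 
  (pushforward (@lebesgue_measure R \x mu) (@cV_cons R n))).
exact: measurable_cV_cons.
Qed.

HB.instance Definition _ := isMeasure.Build _ _ _ lebesgue_cV_step
  step0 step_ge0 step_sigma_additive.

Let step_sigma_finite : sigma_finite setT lebesgue_cV_step.
Proof.
have /sigma_finiteP[F [TF ndF Foo]] := sigma_finiteT (@lebesgue_measure R).
have /sigma_finiteP[G [TG ndG Goo]] := sigma_finiteT mu.
exists (fun k => @cV_uncons R n @^-1` (F k `*` G k)).
  rewrite predeqE => v; split=> // _.
  have [i _ Fx] : (\bigcup_i F i) (cV_uncons v).1 by rewrite -TF.
  have [j _ Gw] : (\bigcup_i G i) (cV_uncons v).2 by rewrite -TG.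
  exists (maxn i j) => //; split => /=.
    by have /subsetPset := ndF i (maxn i j) (leq_maxl i j); apply.
  by have /subsetPset := ndG j (maxn i j) (leq_maxr i j); apply.
move=> k; have [mF Fk] := Foo k; have [mG Gk] := Goo k; split.
  rewrite -[X in measurable X]setTI.
  by apply: measurable_cV_uncons => //; exact: measurableX.
rewrite /lebesgue_cV_step /pushforward -comp_preimage.
rewrite (_ : _ \o _ = id) ?preimage_id; last exact/funext/cV_consK.
by rewrite product_measure1E// lte_mul_pinfty// ge0_fin_numE.
Qed.

HB.instance Definition _ := Measure_isSigmaFinite.Build _ _ _
  lebesgue_cV_step step_sigma_finite.

End lebesgue_cV_step.

(* n-dimensional Lebesgue measure, as the n-fold product of [lebesgue_measure]. *)
Fixpoint lebesgue_cV {R : realType} n :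
    {sigma_finite_measure set 'cV[R]_n -> \bar R} :=
  if n is n'.+1 then lebesgue_cV_step (lebesgue_cV n') else \d_(0 : 'cV[R]_0).

Section affine_maps.
Context {R : realType} (d : nat).

(* The pair (A, t) stands for the affine map x |-> A x + t. *)
Definition aff : Type := ('M[R]_d * 'cV[R]_d)%type.

Implicit Types (u v w : aff) (x y : 'cV[R]_d) (G : set aff).

Definition aff_app u x : 'cV[R]_d := u.1 *m x + u.2.
Definition aff_comp u v : aff := (u.1 *m v.1, u.1 *m v.2 + u.2).
Definition aff_inv u : aff := (invmx u.1, - (invmx u.1 *m u.2)).
Definition linear_aff (A : 'M[R]_d) : aff := (A, 0).
Definition translation x : aff := (1%:M, x).

Definition dotv x y : R := \sum_i x i ord0 * y i ord0.
Definition enorm x : R := Num.sqrt (dotv x x).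

Definition aff_isometry u :=
  forall x y, enorm (aff_app u x - aff_app u y) = enorm (x - y).

Definition aff_subgroup G :=
  [/\ G (translation 0),
      forall u v, G u -> G v -> G (aff_comp u v)
    & forall u, G u -> G (aff_inv u)].

(* The topology on affine maps is that of the pairs (A, t). *)
Definition aff_discrete G :=
  forall u, G u ->
    \forall v \near (u : 'M[R]_d * 'cV[R]_d), G v -> v = u.

Definition fundamental_domain G (P : set 'cV[R]_d) :=
  (forall x, exists2 u, G u & (aff_app u @` P) x) /\
  (forall u v, G u -> G v -> u <> v ->
     (aff_app u @` P°) `&` (aff_app v @` P°) = set0).

Definition crystal_group G :=
  [/\ aff_subgroup G,
      forall u, G u -> aff_isometry u,
      aff_discrete G
    & exists2 P, compact P & fundamental_domain G P].

Definition full_rank_lattice (L : set 'cV[R]_d) :=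
  exists2 B : 'M[R]_d, B \in unitmx
    & L = range (fun z : 'cV[int]_d => B *m map_mx intr z).

Definition dual_lattice (L : set 'cV[R]_d) : set 'cV[R]_d :=
  [set xi | forall k, L k -> dotv k xi \is a Num.int].

(* The element (g, k) of a splitting crystal group: x |-> g (x + k). *)
Definition crystal (g : 'M[R]_d) (k : 'cV[R]_d) : aff := (g, g *m k).

(* [g] enumerates the point group without repetition, [g ord0] being the
   identity.  That the translations form a full rank lattice and that the point
   group is finite follow from Bieberbach's theorem; they are part of the data
   of a crystal triple. *)
Record splitting_crystal_triple (r : nat) (Gam : set aff)
    (g : 'I_r.+1 -> 'M[R]_d) (Lam : set 'cV[R]_d) : Prop := {
  sct_crystal : crystal_group Gam ;
  sct_trans : Lam = [set k | Gam (translation k)] ;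
  sct_lattice : full_rank_lattice Lam ;
  sct_point_group : range g = [set u.1 | u in Gam] ;
  sct_inj : injective g ;
  sct_id : g ord0 = 1%:M ;
  sct_split : Gam = [set u | exists i, exists2 k, Lam k & u = crystal (g i) k]
}.

Definition admissible (Gam : set aff) (a : 'M[R]_d) :=
  (forall z : R[i], eigenvalue (map_mx (real_complex R) a) z -> 1 < `|z|) /\
  (forall u, Gam u ->
     Gam (aff_comp (aff_comp (linear_aff a) u) (aff_inv (linear_aff a)))).

(* [c] is a complete set of representatives of L / b L, without repetition. *)
Definition coset_reps m (L : set 'cV[R]_d) (b : 'M[R]_d)
    (c : 'I_m -> 'cV[R]_d) :=
  (forall s, L (c s)) /\
  (forall k, L k -> exists! s, (mulmx b @` L) (k - c s)).

(* By Hutchinson's theorem the equation has exactly one nonempty compact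
   solution Q. *)
Definition tiling_digits m (L : set 'cV[R]_d) (a : 'M[R]_d)
    (c : 'I_m -> 'cV[R]_d) :=
  coset_reps L a c /\
  exists Q : set 'cV[R]_d,
    [/\ compact Q, Q !=set0,
        mulmx a @` Q = \bigcup_(s in [set: 'I_m]) [set x + c s | x in Q]
      & \bigcup_(k in L) [set x + k | x in Q] = [set: 'cV[R]_d]].

End affine_maps.
Arguments aff R d : clear implicits.

Section L2.
Context {R : realType} (d : nat).
Local Notation leb := (@lebesgue_cV R d).
Local Notation fn := ('cV[R]_d -> R[i]).
Implicit Types (f h : fn) (V W : set fn).

(* An element of L^2(R^d) is represented by any of the square integrable
   functions in its class.  A subspace of L^2 is the set of all representatives
   of its elements: [L2closure] absorbs changes on null sets. *)
Definition L2 : set fn :=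
  [set f | (fun x => complex.Re (f x)) \in Lfun leb 2%:E /\
           (fun x => complex.Im (f x)) \in Lfun leb 2%:E].

Definition ip f h : R[i] :=
  (\int[leb]_x complex.Re (f x * (h x)^*)%R)%R +i*
  (\int[leb]_x complex.Im (f x * (h x)^*)%R)%R.

Definition L2norm f : R := Num.sqrt (complex.Re (ip f f)).

Definition L2closure V : set fn :=
  [set f | L2 f /\
     forall e : R, 0 < e -> exists2 h, V h & L2norm (fun x => f x - h x) < e].

Definition closed_subspace V :=
  [/\ V `<=` L2, V (fun=> 0),
      forall (z : R[i]) f h, V f -> V h -> V (fun x => z * f x + h x)
    & L2closure V `<=` V].

Definition orthocomplement V W : set fn :=
  [set f | V f /\ forall h, W h -> ip f h = 0].

Section families.
Context {I : choiceType}.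
Implicit Types (D : set I) (e : I -> fn).

Definition lin_span D e : set fn :=
  [set f | exists A : {fset I}, exists b : I -> R[i],
     [set` A] `<=` D /\ f = fun x => \sum_(i <- A) b i * e i x].

Definition orthonormal_family D e :=
  forall i j, D i -> D j -> ip (e i) (e j) = (i == j)%:R.

Definition orthonormal_basis D e V :=
  [/\ forall i, D i -> L2 (e i), orthonormal_family D e
    & L2closure (lin_span D e) = V].

(* [f] is the unconditional L^2 sum of the family [e] over [D]. *)
Definition L2sum D e f :=
  forall eps : R, 0 < eps ->
  exists2 A0 : {fset I}, [set` A0] `<=` D &
    forall A : {fset I}, [set` A] `<=` D -> [set` A0] `<=` [set` A] ->
      L2norm (fun x => f x - \sum_(i <- A) e i x) < eps.

End families.

Definition dilate (u : aff R d) f : fn :=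
  fun x => ((Num.sqrt `|\det u.1|)^-1)%:C * f (aff_app (aff_inv u) x).

Record is_MRA (Gam : set (aff R d)) (a : 'M[R]_d) (n : nat)
    (V : int -> set fn) (phi : 'I_n -> fn) : Prop := {
  mra_closed : forall j, closed_subspace (V j) ;
  mra_incr : forall j, V j `<=` V (j + 1) ;
  (* [dilate _ @^-1` _] is the image under the inverse of the bijection D_a *)
  mra_dilate : forall j, V (j + 1) = dilate (linear_aff a) @^-1` (V j) ;
  mra_inter : forall f, (forall j, V j f) -> {ae leb, forall x, f x = 0} ;
  mra_dense : L2closure (\bigcup_j V j) = L2 ;
  mra_scaling : orthonormal_basis
    [set p : 'M[R]_d * 'cV[R]_d * 'I_n | Gam p.1]
    (fun p => dilate p.1 (phi p.2)) (V 0)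
}.

End L2.

Section refinement.
Context {R : realType} (d r : nat).
Local Notation fn := ('cV[R]_d -> R[i]).
Variables (g : 'I_r.+1 -> 'M[R]_d) (Lam : set 'cV[R]_d) (a : 'M[R]_d).

Definition Phi (phi : fn) (i : 'I_r.+1) : fn := fun x => phi (invmx (g i) *m x).

(* [h] and [p] are the indices h_i and rho_i(j): g h = a (g i) a^-1 and
   g p = (g h)^-1 (g j). *)
Definition crystal_symmetry (ck : 'cV[R]_d -> 'M[R[i]]_r.+1) :=
  forall (k : 'cV[R]_d) (i j h p : 'I_r.+1), Lam k ->
    g h = a *m g i *m invmx a -> g p = invmx (g h) *m g j ->
    ck k i j = ck (invmx (g h) *m k) ord0 p.

Definition VV1 (V1 : set fn) (phi : fn) : set ('I_r.+1 -> fn) :=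
  [set F | (forall i, V1 (F i)) /\
     exists2 ck, crystal_symmetry ck &
       forall i, L2sum Lam
         (fun k x => \sum_j ck k i j * Phi phi j (a *m x - k)) (F i)].

Definition refinable (Gam : set (aff R d)) (phi : fn) (c : aff R d -> R[i])
    (psi : fn) :=
  finite_set (Gam `&` [set u | c u != 0]) /\
  {ae @lebesgue_cV R d, forall x,
     psi x = \sum_(u \in Gam) c u * phi (aff_app (aff_inv u) (a *m x))}.

Definition Psi (psi : fn) (i : 'I_r.+1) : fn := dilate (linear_aff (g i)) psi.

Definition ctilde (c : aff R d -> R[i]) (k : 'cV[R]_d) : 'M[R[i]]_r.+1 :=
  \matrix_(i, j)
    c (crystal (invmx (a *m g i *m invmx a) *m g j) (invmx (g j) *m k)).

(* e^{-2 pi i k . omega} *)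
Definition expchar (k omega : 'cV[R]_d) : R[i] :=
  let t := 2 * pi * dotv k omega in cos t -i* sin t.

Variable m : nat.

Definition refinement_mask (c : aff R d -> R[i]) (omega : 'cV[R]_d) : 'M[R[i]]_r.+1 :=
  m%:R^-1 *: \sum_(k \in Lam) expchar k omega *: ctilde c k.

Definition polyphase (c : aff R d -> R[i]) (dh omega : 'cV[R]_d) :
    'M[R[i]]_r.+1 :=
  ((Num.sqrt m%:R)^-1)%:C *:
    \sum_(k \in Lam) expchar k omega *: ctilde c (a *m k + dh).

Definition Mblock (rho : 'I_m -> 'cV[R]_d) (c : 'I_m -> aff R d -> R[i])
    (omega : 'cV[R]_d) :=
  \mxblock_(i < m, j < m) refinement_mask (c i) (omega + invmx a^T *m rho j).

Definition Ublock (dig : 'I_m -> 'cV[R]_d) (c : 'I_m -> aff R d -> R[i])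
    (omega : 'cV[R]_d) :=
  \mxblock_(l < m, h < m) polyphase (c l) (dig h) omega.

End refinement.

(* Main.v *)
Require Import Defs.
From HB Require Import structures.
From mathcomp Require Import all_boot all_order all_algebra.
From mathcomp Require Import all_classical all_reals all_analysis.
From mathcomp Require Import finmap.
From mathcomp Require Import complex measurable_realfun ring lra.

(** The vectors [D_a^-1 D_gamma phi] form an orthonormal basis of [V 1]. Conjugation by
    [a] gives [D_beta D_a^-1 = D_a^-1 D_(a beta a^-1)], so the refinement equation of
    [psi l] yields the expansion of every [D_beta psi l] in this basis: its
    coefficients are [m^(-1/2)] times a left translate, by [a beta a^-1], of the
    single function [c l] on the group ([dilate_refinable], [ip_dilate_psi]). The
    entries of the matrices [ctilde] are exactly the values of these translates
    ([ctildeE]). Two consequences follow. The symmetry of the coefficient matrices,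
    and with it the membership of [Psi] in [VV1], always holds ([ctilde_symmetry],
    [Psi_VV1]). And the sums in (d) are the inner products of the [D_gamma psi l],
    so (d) says that these vectors are orthonormal for [l] from [0] to [m - 1]
    ([shift_orthonormalP]).

    The same sums are the Fourier coefficients of the entries of [U U^*], once the
    lattice is split into the cosets of the digits ([polyphase_gram]). Since a
    trigonometric polynomial vanishing almost everywhere has zero coefficients
    ([trig_ae_eq0]), (d) is equivalent to the unitarity of [U] almost everywhere, and
    then [U] is unitary everywhere. Moreover [M omega = U (a^T omega) W omega] where
    [W] is the matrix of characters of the dual quotient at the digits
    ([Mblock_factor]); character orthogonality makes [W] unitary, so (b) and (c) are
    equivalent.

    It remains to compare (d) with (a). If (a) holds, then the dilates of [psi 0 = phi]
    are orthonormal, and the other ones are orthonormal and orthogonal to [V 0].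
    Conversely, (d) gives orthonormality, and completeness comes from the fact that
    [U] is a square matrix: its columns are orthonormal too, and their constant Fourier
    coefficients say that every basis vector of [V 1] satisfies Parseval's identity
    with respect to the [D_gamma psi l] ([shift_orthonormal_columns],
    [dbasis_in_span]). Hence these span [V 1], and removing the dilates of [phi],
    which span [V 0], leaves a basis of the orthogonal complement
    ([orthocomplement_span]).

    That dilations are unitary and preserve null sets rests on the change of variables
    formula for invertible matrices, proved by Tonelli's theorem and block elimination
    ([scales_integral_unit]). *)

Set Implicit Arguments.
Unset Strict Implicit.
Unset Printing Implicit Defensive.
Import Order.TTheory GRing.Theory Num.Theory.
Import numFieldNormedType.Exports.

Local Open Scope classical_set_scope.
Local Open Scope ring_scope.
Local Open Scope complex_scope.
Local Open Scope sesquilinear_scope.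

(** * Lebesgue measure under affine maps *)

Section lebesgue_line.
Local Open Scope ereal_scope.
Context {R : realType}.
Local Notation leb := (@lebesgue_measure R).

Lemma measurable_affine_line (p t : R) :
  measurable_fun [set: R] (fun x : R => p * x + t)%R.
Proof. by apply: measurable_funD => //; exact: measurable_funM. Qed.

(** Lebesgue measure is determined by its values on half-open intervals, and an
    affine map sends intervals to intervals. *)
Lemma lebesgue_measure_affine (p t : R) (A : set R) : p != 0%R -> measurable A ->
  leb ((fun x : R => p * x + t)%R @^-1` A) = (`|p|^-1)%:E * leb A.
Proof.
move=> p0 mA.
have np0 : (0 < `|p|)%R by rewrite normr_gt0.
pose k : {nonneg R} := NngNum (normr_ge0 p).
suff -> : leb A = `|p|%:E * leb ((fun x : R => p * x + t)%R @^-1` A).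
  by rewrite muleA -EFinM mulVf ?mul1e// gt_eqF.
pose mu : {measure set (measurableTypeR R) -> \bar R} :=
  mscale k (pushforward leb (fun x : measurableTypeR R => p * x + t : measurableTypeR R)%R).
have mf : measurable_fun [set: measurableTypeR R]
  (fun x : measurableTypeR R => p * x + t : measurableTypeR R)%R.
  exact: measurable_affine_line.
suff H : forall X, ocitv X -> leb X = mu mf X.
  exact: (lebesgue_measure_unique H mA).
move=> _ [[a b] _ <-].
rewrite /mu /= /mscale/= /pushforward/=.
case: (ltP 0%R p) => [pp|pn].
  have -> : (fun x : R => p * x + t)%R @^-1` [set` `]a, b]%R] =
      [set` `](a - t) / p, (b - t) / p]%R]%R.
    apply/seteqP; split=> x /=; rewrite !in_itv/= ltr_pdivrMr// ler_pdivlMr//;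
    by rewrite ltrBlDr lerBrDr mulrC.
  rewrite !lebesgue_measure_itv/= !lte_fin ltr_pM2r ?invr_gt0// ltrD2r.
  case: ifP => _; last by rewrite mule0.
  rewrite -!EFinB -EFinM; congr EFin; rewrite gtr0_norm//.
  by field.
have {}pn : (p < 0)%R by rewrite lt_neqAle p0.
have -> : (fun x : R => p * x + t)%R @^-1` [set` `]a, b]%R] =
      [set` `[(b - t) / p, (a - t) / p[%R]%R.
  apply/seteqP; split=> x /=; rewrite !in_itv/= ltr_ndivlMr// ler_ndivrMr//;
  by rewrite ltrBlDr lerBrDr mulrC andbC.
rewrite !lebesgue_measure_itv/= !lte_fin ltr_nM2r ?invr_lt0// ltrD2r.
case: ifP => _; last by rewrite mule0.
rewrite -!EFinB -EFinM; congr EFin; rewrite ltr0_norm//.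
by field.
Qed.

Lemma ge0_integral_affine_line (p t : R) (f : R -> \bar R) : p != 0%R ->
  measurable_fun [set: R] f -> (forall x, 0 <= f x) ->
  \int[leb]_x f (p * x + t)%R = (`|p|^-1)%:E * \int[leb]_x f x.
Proof.
move=> p0 mf f0.
pose k : {nonneg R} := NngNum (normr_ge0 (p^-1)%R).
have ma : measurable_fun [set: measurableTypeR R]
  (fun x : measurableTypeR R => p * x + t : measurableTypeR R)%R.
  exact: measurable_affine_line.
have := ge0_integral_pushforward ma leb (@measurableT _ _) mf
  (fun x _ => f0 x).
rewrite preimage_setT => <-.
rewrite -normfV -[X in X%:E]/(k%:num) -ge0_integral_mscale//.
apply: eq_measure_integral => A mA _.
by rewrite /= /mscale /pushforward/= normfV lebesgue_measure_affine.
Qed.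
End lebesgue_line.

Section lebesgue_space.
Local Open Scope ereal_scope.
Context {R : realType}.
Local Notation leb n := (@lebesgue_cV R n).

Lemma measurable_affine_cV n (A : 'M[R]_n) (t : 'cV[R]_n) :
  measurable_fun [set: 'cV[R]_n] (fun v => A *m v + t)%R.
Proof.
apply/measurable_fun_cVP => i.
under eq_fun do rewrite !mxE.
apply: measurable_funD => //; apply: measurable_sum => j.
apply: measurable_funM => //; exact: measurable_cV_coord.
Qed.

Lemma measurable_mulmx_cV n (A : 'M[R]_n) :
  measurable_fun [set: 'cV[R]_n] (mulmx A).
Proof.
have := measurable_affine_cV A 0.
by under eq_fun do rewrite addr0.
Qed.

Lemma ge0_integral_lebesgue_cVS n (f : 'cV[R]_n.+1 -> \bar R) :
  measurable_fun [set: 'cV[R]_n.+1] f -> (forall x, 0 <= f x) ->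
  \int[leb n.+1]_v f v =
  \int[@lebesgue_measure R]_x \int[leb n]_w f (cV_cons (x, w)).
Proof.
move=> mf f0.
have mcons : measurable_fun [set: measurableTypeR R * 'cV[R]_n] (@cV_cons R n).
  exact: measurable_cV_cons.
have := ge0_integral_pushforward mcons (@lebesgue_measure R \x leb n) (@measurableT _ _) mf
  (fun x _ => f0 x).
rewrite preimage_setT => -> /=.
rewrite fubini_tonelli1//.
by apply: measurableT_comp => //; exact: measurable_cV_cons.
Qed.

(** Induction on the dimension: by Tonelli's theorem, a translation acts on the first
    coordinate and on the remaining ones separately. *)
Lemma ge0_integral_translate_cV n (t : 'cV[R]_n) (f : 'cV[R]_n -> \bar R) :
  measurable_fun [set: 'cV[R]_n] f -> (forall x, 0 <= f x) ->
  \int[leb n]_v f (v + t)%R = \int[leb n]_v f v.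
Proof.
elim: n t f => [|n IH] t f mf f0.
  by congr integral; apply/funext => v; congr f; apply/matrixP => -[].
have mft : measurable_fun [set: 'cV[R]_n.+1] (fun v => f (v + t)%R).
  have := measurableT_comp mf (measurable_affine_cV 1%:M t).
  by rewrite /comp; under eq_fun do rewrite mul1mx.
etransitivity; first exact: (ge0_integral_lebesgue_cVS mft (fun v => f0 _)).
rewrite (ge0_integral_lebesgue_cVS mf f0).
pose s := @dsubmx R 1 n 1 t.
have E x w : (cV_cons (x, w) + t = cV_cons (1 * x + t ord0 ord0, w + s))%R.
  rewrite -[t in LHS]cV_unconsK /cV_cons/= /cV_uncons.
  by rewrite [LHS](@add_col_mx R 1 n 1)/= -raddfD/= mul1r.
pose F x := \int[leb n]_w f (cV_cons (x, w)).
have mc y : measurable_fun [set: 'cV[R]_n] (fun w => f (cV_cons (y, w))).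
  apply: measurableT_comp => //; apply: measurableT_comp => //.
  exact: measurable_cV_cons.
transitivity (\int[@lebesgue_measure R]_x F (1 * x + t ord0 ord0)%R).
  apply: eq_integral => x _.
  by rewrite -[RHS](IH s)//; apply: eq_integral => w _; rewrite E.
rewrite ge0_integral_affine_line.
- by rewrite normr1 invr1 mul1e.
- exact: oner_neq0.
- apply: (@measurable_fun_fubini_tonelli_F _ _ _ _ _ (leb n) (f \o @cV_cons R n)) => //.
  by apply: measurableT_comp => //; exact: measurable_cV_cons.
- by move=> x; exact: f0.
- by move=> x; apply: integral_ge0 => w _; exact: f0.
Qed.

End lebesgue_space.

Section lebesgue_linear.
Local Open Scope ereal_scope.
Context {R : realType}.
Local Notation leb n := (@lebesgue_cV R n).

Definition scales_integral n (A : 'M[R]_n) :=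
  forall f : 'cV[R]_n -> \bar R,
  measurable_fun [set: 'cV[R]_n] f -> (forall x, 0 <= f x) ->
  \int[leb n]_v f (A *m v)%R = (`|\det A|^-1)%:E * \int[leb n]_v f v.

Lemma scales_integralM n (A B : 'M[R]_n) :
  scales_integral A -> scales_integral B -> scales_integral (A *m B).
Proof.
move=> hA hB f mf f0.
have mfA : measurable_fun [set: 'cV[R]_n] (fun v => f (A *m v)%R).
  exact: (measurableT_comp mf (measurable_mulmx_cV A)).
transitivity (\int[leb n]_v f (A *m (B *m v))%R).
  by apply: eq_integral => v _; rewrite mulmxA.
rewrite (hB _ mfA (fun v => f0 _)) (hA _ mf f0) muleA -EFinM.
by rewrite -invfM -normrM mulrC det_mulmx.
Qed.

Lemma mulmx_block_cV_cons n (p : R) (u : 'rV[R]_n) (v : 'cV[R]_n) (B : 'M[R]_n)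
    x w :
  (@block_mx R 1 n 1 n p%:M u v B *m (cV_cons (x, w) : 'cV[R]_n.+1) =
  cV_cons (p * x + (u *m w) ord0 ord0, x *: v + B *m w))%R.
Proof.
rewrite /cV_cons/= mul_block_col; congr col_mx.
  by apply/matrixP => i j; rewrite !ord1 !mxE big_ord1 !mxE eqxx.
by rewrite mul_mx_scalar.
Qed.

(** For a fixed first coordinate, a lower shear translates the other coordinates. *)
Lemma scales_integral_block_lower n (v : 'cV[R]_n) :
  scales_integral (@block_mx R 1 n 1 n 1%:M 0 v 1%:M : 'M[R]_n.+1).
Proof.
move=> f mf f0.
set L : 'M[R]_n.+1 := @block_mx R 1 n 1 n _ _ _ _.
have mfL : measurable_fun [set: 'cV[R]_n.+1] (fun v => f (L *m v)%R).
  exact: (measurableT_comp mf (measurable_mulmx_cV L)).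
have -> : \det L = 1%R by rewrite /L (@det_lblock R 1 n) !det1 mulr1.
rewrite normr1 invr1 mul1e.
etransitivity; first exact: (ge0_integral_lebesgue_cVS mfL (fun v => f0 _)).
rewrite (ge0_integral_lebesgue_cVS mf f0).
apply: eq_integral => x _.
have mfx : measurable_fun [set: 'cV[R]_n] (fun w => f (cV_cons (x, w))).
  apply: measurableT_comp => //; apply: measurableT_comp => //.
  exact: measurable_cV_cons.
rewrite -(ge0_integral_translate_cV (x *: v)%R mfx (fun w => f0 _)).
apply: eq_integral => w _.
by rewrite mulmx_block_cV_cons mul1r mul0mx mxE addr0 mul1mx addrC.
Qed.

(** For fixed last coordinates, the first one undergoes an affine map of the line, so
    the integral over it has to be the inner one: the order of integration is
    exchanged twice. *)
Lemma scales_integral_block_upper n (p : R) (u : 'rV[R]_n) (B : 'M[R]_n) :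
  p != 0%R -> scales_integral B ->
  scales_integral (@block_mx R 1 n 1 n p%:M u 0 B : 'M[R]_n.+1).
Proof.
move=> p0 hB f mf f0.
set U : 'M[R]_n.+1 := @block_mx R 1 n 1 n _ _ _ _.
have mfU : measurable_fun [set: 'cV[R]_n.+1] (fun v => f (U *m v)%R).
  exact: (measurableT_comp mf (measurable_mulmx_cV U)).
have -> : \det U = (p * \det B)%R by rewrite /U (@det_ublock R 1 n) det_scalar1.
etransitivity; first exact: (ge0_integral_lebesgue_cVS mfU (fun v => f0 _)).
rewrite (ge0_integral_lebesgue_cVS mf f0).
have mfc : measurable_fun [set: measurableTypeR R * 'cV[R]_n] (f \o @cV_cons R n).
  by apply: measurableT_comp => //; exact: measurable_cV_cons.
have mfUc : measurable_fun [set: measurableTypeR R * 'cV[R]_n]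
    ((fun v => f (U *m v)%R) \o @cV_cons R n).
  by apply: measurableT_comp => //; exact: measurable_cV_cons.
have mfw w : measurable_fun [set: R] (fun x => f (cV_cons (x, w))).
  apply: measurableT_comp => //; apply: measurableT_comp => //.
  exact: measurable_cV_cons.
have mfx x : measurable_fun [set: 'cV[R]_n] (fun w => f (cV_cons (x, w))).
  apply: measurableT_comp => //; apply: measurableT_comp => //.
  exact: measurable_cV_cons.
etransitivity; first exact: (fubini_tonelli _ mfUc (fun v => f0 _)).
transitivity (\int[leb n]_w ((`|p|^-1)%:E *
    \int[@lebesgue_measure R]_x f (cV_cons (x, B *m w)%R))).
  apply: eq_integral => w _.
  rewrite -(ge0_integral_affine_line ((u *m w) ord0 ord0) p0 (mfw _) (fun x => f0 _)).
  apply: eq_integral => x _ /=.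
  by rewrite mulmx_block_cV_cons scaler0 add0r.
pose G w := \int[@lebesgue_measure R]_x f (cV_cons (x, w)).
have mG : measurable_fun [set: 'cV[R]_n] G.
  exact: (measurable_fun_fubini_tonelli_G _ mfc (fun v => f0 _)).
have G0 w : 0 <= G w by apply: integral_ge0 => x _; exact: f0.
have mGB : measurable_fun [set: 'cV[R]_n] (G \o mulmx B).
  exact: (measurableT_comp mG (measurable_mulmx_cV B)).
rewrite (@ge0_integralZl _ _ _ _ _ _ (G \o mulmx B))//; last first.
  by move=> w _; exact: G0.
rewrite (hB _ mG G0) muleA -EFinM -invfM -normrM; congr (_ * _).
apply: esym; exact: (fubini_tonelli _ mfc (fun v => f0 _)).
Qed.

(** The scaling property is multiplicative, and Gaussian elimination on the first row
    and column factors an invertible matrix into block triangular matrices, to which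
    the induction hypothesis applies. *)
Lemma scales_integral_unit n (A : 'M[R]_n) : A \in unitmx -> scales_integral A.
Proof.
elim: n A => [|n IH] A uA.
  move=> f mf f0; rewrite det_mx00 normr1 invr1 mul1e.
  by apply: eq_integral => v _; congr f; apply/matrixP => -[] //.
have unit_block (p : R) u v B : p != 0%R ->
    (@block_mx R 1 n 1 n p%:M u v B : 'M[R]_n.+1) \in unitmx ->
    scales_integral (@block_mx R 1 n 1 n p%:M u v B : 'M[R]_n.+1).
  move=> p0.
  have -> : (@block_mx R 1 n 1 n p%:M u v B) =
      (@block_mx R 1 n 1 n 1%:M 0 (p^-1 *: v) 1%:M : 'M[R]_n.+1) *m
      (@block_mx R 1 n 1 n p%:M u 0 (B - p^-1 *: v *m u)).
    rewrite (@mulmx_block R 1 n 1 n 1 n) !mul1mx !mul0mx !addr0.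
    by rewrite mul_mx_scalar scalerA divff// scale1r addrC subrK.
  rewrite unitmx_mul => /andP[_].
  rewrite unitmxE (@det_ublock R 1 n) unitrM -!unitmxE => /andP[_ uB].
  apply: scales_integralM; first exact: scales_integral_block_lower.
  exact: (scales_integral_block_upper _ p0 (IH _ uB)).
have [p [u [v [B AE]]]] : exists p u v B, A = @block_mx R 1 n 1 n p%:M u v B.
  exists (A ord0 ord0), (@ursubmx R 1 n 1 n A), (@dlsubmx R 1 n 1 n A),
    (@drsubmx R 1 n 1 n A).
  have -> : (A ord0 ord0)%:M = @ulsubmx R 1 n 1 n A.
    apply/matrixP => i j; rewrite !ord1 !mxE eqxx mulr1n.
    by congr (A _ _); apply: val_inj.
  by rewrite (@submxK R 1 n 1 n).
have [p0|p0] := eqVneq p 0%R; last by move: uA; rewrite AE; exact: unit_block.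
(* a zero pivot is repaired by adding a suitable lower row to the first one *)
have [i vi0] : exists i, v i ord0 != 0%R.
  apply/existsP; apply: contraLR uA; rewrite negb_exists => /forallP v0.
  have {}v0 : v = 0%R.
    by apply/matrixP => j k; rewrite ord1 mxE; apply/eqP; rewrite -[_ == _]negbK.
  by rewrite AE p0 v0 unitmxE (@det_ublock R 1 n) det_scalar1 mul0r unitr0.
pose e : 'rV[R]_n := delta_mx ord0 i.
have AE' : A = (@block_mx R 1 n 1 n 1%:M (- e) 0 1%:M : 'M[R]_n.+1) *m
    (@block_mx R 1 n 1 n (v i ord0)%:M (u + e *m B) v B).
  rewrite (@mulmx_block R 1 n 1 n 1 n) !mul1mx !mul0mx !add0r.
  rewrite AE p0 raddf0 !mulNmx addrK; congr (@block_mx _ 1 n 1 n _ _ _ _).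
  apply/eqP; rewrite eq_sym subr_eq0; apply/eqP.
  by apply/matrixP => j k; rewrite !ord1 -rowE !mxE eqxx.
move: uA; rewrite AE' unitmx_mul => /andP[_ uX].
apply: scales_integralM; last exact: unit_block.
apply: scales_integral_block_upper; first exact: oner_neq0.
move=> f mf f0; rewrite det1 normr1 invr1 mul1e.
by apply: eq_integral => w _; rewrite mul1mx.
Qed.

Lemma ge0_integral_affine_cV n (A : 'M[R]_n) t (f : 'cV[R]_n -> \bar R) :
  A \in unitmx ->
  measurable_fun [set: 'cV[R]_n] f -> (forall x, 0 <= f x) ->
  \int[leb n]_v f (A *m v + t)%R = (`|\det A|^-1)%:E * \int[leb n]_v f v.
Proof.
move=> uA mf f0.
have mft : measurable_fun [set: 'cV[R]_n] (fun v => f (v + t)%R).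
  have := measurableT_comp mf (measurable_affine_cV 1%:M t).
  by rewrite /comp; under eq_fun do rewrite mul1mx.
rewrite (scales_integral_unit uA mft (fun v => f0 _)).
by rewrite ge0_integral_translate_cV.
Qed.

Lemma integral_affine_cV n (A : 'M[R]_n) t (f : 'cV[R]_n -> \bar R) :
  A \in unitmx -> (leb n).-integrable [set: 'cV[R]_n] f ->
  \int[leb n]_v f (A *m v + t)%R = (`|\det A|^-1)%:E * \int[leb n]_v f v.
Proof.
move=> uA intf.
have mf : measurable_fun [set: 'cV[R]_n] f by case/integrableP: intf.
rewrite integralE [in RHS]integralE.
have E := ge0_integral_affine_cV t uA.
have -> : \int[leb n]_v (fun v => f (A *m v + t)%R)^\+ v =
    (`|\det A|^-1)%:E * \int[leb n]_v f^\+ v.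
  rewrite -(E _ (measurable_funepos mf) (fun v => funepos_ge0 _ _)).
  by apply: eq_integral => v _; rewrite !funeposE.
have -> : \int[leb n]_v (fun v => f (A *m v + t)%R)^\- v =
    (`|\det A|^-1)%:E * \int[leb n]_v f^\- v.
  rewrite -(E _ (measurable_funeneg mf) (fun v => funeneg_ge0 _ _)).
  by apply: eq_integral => v _; rewrite !funenegE.
rewrite [RHS]muleBr//.
exact: (integrable_add_def measurableT intf).
Qed.

Lemma integrable_affine_cV n (A : 'M[R]_n) t (f : 'cV[R]_n -> \bar R) :
  A \in unitmx -> (leb n).-integrable [set: 'cV[R]_n] f ->
  (leb n).-integrable [set: 'cV[R]_n] (fun v => f (A *m v + t)%R).
Proof.
move=> uA /integrableP[mf fi]; apply/integrableP; split.
  exact: (measurableT_comp mf (measurable_affine_cV A t)).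
rewrite (@ge0_integral_affine_cV _ A t (fun v => `|f v|))//.
  by apply: lte_mul_pinfty => //; rewrite lee_fin.
exact: measurableT_comp.
Qed.

(** The preimage of a null set is null, as the scaling of integrals applied to an
    indicator function shows. *)
Lemma ae_affine_cV n (A : 'M[R]_n) t (P : 'cV[R]_n -> Prop) : A \in unitmx ->
  {ae leb n, forall v, P v} -> {ae leb n, forall v, P (A *m v + t)%R}.
Proof.
move=> uA [N [mN N0 PN]].
have ma := measurable_affine_cV A t.
exists ((fun v => A *m v + t)%R @^-1` N); split.
- by rewrite -[X in measurable X]setTI; exact: ma.
- have mi : measurable_fun [set: 'cV[R]_n] (fun v => (\1_N v : R)%:E).
    exact: measurableT_comp.
  have i0 v : 0 <= (\1_N v : R)%:E by rewrite lee_fin.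
  transitivity (\int[leb n]_v (\1_N (A *m v + t)%R : R)%:E).
    rewrite -[X in _ X = _]setIT -integral_indic//.
    by rewrite -[X in measurable X]setTI; exact: ma.
  rewrite (ge0_integral_affine_cV t uA mi i0) integral_indic// setIT.
  by rewrite [X in _ * X](N0 : _ = 0) mule0.
- by move=> v /= nP; apply: PN.
Qed.

Lemma lebesgue_cV_setT_gt0 n : 0 < leb n [set: 'cV[R]_n].
Proof.
elim: n => [|n IH]; first by rewrite /= diracT.
rewrite /= /lebesgue_cV_step/= /pushforward preimage_setT -setXTT.
rewrite product_measure1E// mule_gt0//.
apply: (@lt_le_trans _ _ (@lebesgue_measure R `[0%R, 1%R])).
  by rewrite lebesgue_measure_itv/= lte01 sube0 lte01.
apply: le_measure => //; apply: mem_set; [exact: measurable_itv|exact: measurableT].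
Qed.

End lebesgue_linear.

(** * Square integrable complex functions *)

Section complex_L2.
Context {R : realType} (d : nat).
Local Notation leb := (@lebesgue_cV R d).
Local Notation fn := ('cV[R]_d -> R[i]).
Implicit Types (f h k : fn) (u v : 'cV[R]_d -> R) (z : R[i]).

(** The norm of [Lfun] is built on real powers of absolute values; for exponent two
    it is the integral of the square. *)
Lemma Lfun2P u : u \in Lfun leb 2%:E <->
  measurable_fun [set: 'cV[R]_d] u /\
  leb.-integrable [set: 'cV[R]_d] (EFin \o (fun x => u x ^+ 2)).
Proof.
split=> [u2|[mu iu]].
  split; last exact: Lfun2_integrable_sqr.
  exact: (set_mem (sub_Lfun_mfun u2)).
apply/andP; split; first exact: mem_set.
apply: mem_set; rewrite /= /finite_norm unlock /Lnorm poweR_lty//=.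
move/integrableP : iu => [_].
congr (_ < _)%E; apply: eq_integral => x _ /=.
by rewrite powR_mulrn// ger0_norm ?sqr_ge0// real_normK// num_real.
Qed.

Lemma Lfun2_lin (a : R) u v : u \in Lfun leb 2%:E -> v \in Lfun leb 2%:E ->
  (fun x => a * u x + v x) \in Lfun leb 2%:E.
Proof.
move=> u2 v2; have p1 : (1 <= 2%:E :> \bar R)%E by rewrite lee_fin ler1n.
have [_ D] := Lfun_addr_closed leb p1.
apply: (D (fun x => a * u x) v) => //.
have := Lfun_scale a (ler1n R 2) u2.
by under eq_fun do rewrite mulrC.
Qed.

Lemma eq_Lfun u v : u =1 v -> u \in Lfun leb 2%:E -> v \in Lfun leb 2%:E.
Proof. by move=> /funext ->. Qed.

Lemma L2_lin z f h : L2 f -> L2 h -> L2 (fun x => z * f x + h x).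
Proof.
case: z => a b [rf imf] [rh imh]; split.
  apply: eq_Lfun (Lfun2_lin a rf (Lfun2_lin (- b) imf rh)) => x.
  by case: (f x) => fr fi; case: (h x) => hr hi /=; rewrite mulNr addrA.
apply: eq_Lfun (Lfun2_lin a imf (Lfun2_lin b rf imh)) => x.
by case: (f x) => fr fi; case: (h x) => hr hi /=; rewrite addrA.
Qed.

Lemma L2_0 : L2 ((fun=> 0) : fn).
Proof.
suff H : (fun=> 0 : R) \in Lfun leb 2%:E by split.
have p1 : (1 <= 2%:E :> \bar R)%E by rewrite lee_fin ler1n.
by have [+ _] := Lfun_addr_closed leb p1.
Qed.

Definition cintegral f : R[i] :=
  (\int[leb]_x complex.Re (f x))%R +i* (\int[leb]_x complex.Im (f x))%R.

Definition cintegrable f :=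
  leb.-integrable [set: 'cV[R]_d] (EFin \o (fun x => complex.Re (f x))) /\
  leb.-integrable [set: 'cV[R]_d] (EFin \o (fun x => complex.Im (f x))).

Lemma integrable_lin (a : R) u v :
  leb.-integrable [set: 'cV[R]_d] (EFin \o u) ->
  leb.-integrable [set: 'cV[R]_d] (EFin \o v) ->
  leb.-integrable [set: 'cV[R]_d] (EFin \o (fun x => a * u x + v x)).
Proof.
move=> iu iv.
have := integrableD measurableT (integrableZl measurableT a iu) iv.
by [].
Qed.

Lemma Rintegral_lin (a : R) u v :
  leb.-integrable [set: 'cV[R]_d] (EFin \o u) ->
  leb.-integrable [set: 'cV[R]_d] (EFin \o v) ->
  (\int[leb]_x (a * u x + v x) = a * \int[leb]_x u x + \int[leb]_x v x)%R.
Proof.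
move=> iu iv; rewrite RintegralD//; last first.
  exact: (integrableZl measurableT a iu).
by rewrite RintegralZl.
Qed.

Lemma cintegral_lin z f h : cintegrable f -> cintegrable h ->
  cintegral (fun x => z * f x + h x) = z * cintegral f + cintegral h.
Proof.
case: z => a b [rf imf] [rh imh]; rewrite /cintegral.
have -> : (fun x => complex.Re ((a +i* b) * f x + h x)) =
    (fun x => a * complex.Re (f x) + ((- b) * complex.Im (f x) + complex.Re (h x))).
  by apply/funext => x; case: (f x) (h x) => ? ? [? ?] /=; rewrite mulNr addrA.
have -> : (fun x => complex.Im ((a +i* b) * f x + h x)) =
    (fun x => a * complex.Im (f x) + (b * complex.Re (f x) + complex.Im (h x))).
  by apply/funext => x; case: (f x) (h x) => ? ? [? ?] /=; rewrite addrA.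
rewrite !Rintegral_lin//; try exact: integrable_lin.
by apply/eqP; rewrite eq_complex /=; apply/andP; split; apply/eqP; ring.
Qed.

Lemma cintegral_conj f : cintegrable f ->
  cintegral (fun x => conjc (f x)) = conjc (cintegral f).
Proof.
move=> [_ fi]; rewrite /cintegral /=; congr (_ +i* _).
  by congr Rintegral; apply/funext => x; case: (f x).
rewrite -mulN1r -RintegralZl//.
by congr Rintegral; apply/funext => x; case: (f x) => p q /=; rewrite mulN1r.
Qed.

Lemma L2_mul f h : L2 f -> L2 h -> cintegrable (fun x => f x * conjc (h x)).
Proof.
move=> [rf imf] [rh imh].
have M u v : u \in Lfun leb 2%:E -> v \in Lfun leb 2%:E ->
    leb.-integrable [set: 'cV[R]_d] (EFin \o (fun x => u x * v x)).
  by move=> u2 v2; apply/Lfun1_integrable; exact: Lfun2_mul_Lfun1.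
split.
  have := integrable_lin 1 (M _ _ rf rh) (M _ _ imf imh).
  congr (integrable _ _ _); apply/funext => x /=; congr EFin.
  by case: (f x) (h x) => ? ? [? ?] /=; rewrite mul1r mulrN opprK.
have := integrable_lin (-1) (M _ _ rf imh) (M _ _ imf rh).
congr (integrable _ _ _); apply/funext => x /=; congr EFin.
by case: (f x) (h x) => ? ? [? ?] /=; rewrite mulN1r mulrN.
Qed.

Lemma ipE f h : ip f h = cintegral (fun x => f x * conjc (h x)).
Proof. by []. Qed.

Lemma ip_linl z f h k : L2 f -> L2 h -> L2 k ->
  ip (fun x => z * f x + h x) k = z * ip f k + ip h k.
Proof.
move=> f2 h2 k2; rewrite !ipE -cintegral_lin; try exact: L2_mul.
by congr cintegral; apply/funext => x; rewrite mulrDl mulrA.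
Qed.

Lemma ip_conj f h : L2 f -> L2 h -> ip f h = conjc (ip h f).
Proof.
move=> f2 h2; rewrite !ipE -cintegral_conj; last exact: L2_mul.
congr cintegral; apply/funext => x.
by rewrite rmorphM /= conjcK mulrC.
Qed.

Lemma ip_linr z f h k : L2 f -> L2 h -> L2 k ->
  ip k (fun x => z * f x + h x) = conjc z * ip k f + ip k h.
Proof.
move=> f2 h2 k2; rewrite (ip_conj k2 (L2_lin z f2 h2)) ip_linl// rmorphD rmorphM.
by rewrite (ip_conj k2 f2) (ip_conj k2 h2).
Qed.

(** Elements of [L2] are functions, not classes, so insensitivity to null sets has
    to be invoked whenever an identity only holds almost everywhere. *)
Lemma ip_ae f f' h h' : L2 f -> L2 f' -> L2 h -> L2 h' ->
  {ae leb, forall x, f x = f' x} -> {ae leb, forall x, h x = h' x} ->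
  ip f h = ip f' h'.
Proof.
move=> f2 f2' h2 h2' ef eh.
have [[mr mi] [mr' mi']] := (L2_mul f2 h2, L2_mul f2' h2').
rewrite !ipE /cintegral; congr (_ +i* _); rewrite /Rintegral; congr fine.
  apply: ae_eq_integral => //; [by case/integrableP: mr|by case/integrableP: mr'|].
  by apply: filterS2 ef eh => x -> ->.
apply: ae_eq_integral => //; [by case/integrableP: mi|by case/integrableP: mi'|].
by apply: filterS2 ef eh => x -> ->.
Qed.

End complex_L2.

(** * The geometry of the inner product *)

Section hilbert.
Context {R : realType} (d : nat).
Local Notation fn := ('cV[R]_d -> R[i]).
Implicit Types (f h k : fn) (V W : set fn) (z : R[i]).

Lemma L2_sub f h : L2 f -> L2 h -> L2 (fun x => f x - h x).
Proof.
move=> f2 h2; have := L2_lin (-1) h2 f2.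
by under eq_fun do rewrite mulN1r addrC.
Qed.

Lemma ip_subl f h k : L2 f -> L2 h -> L2 k ->
  ip (fun x => f x - h x) k = ip f k - ip h k.
Proof.
move=> f2 h2 k2; have := ip_linl (-1) h2 f2 k2.
by under eq_fun do rewrite mulN1r addrC; rewrite mulN1r addrC.
Qed.

Lemma ip_subr f h k : L2 f -> L2 h -> L2 k ->
  ip k (fun x => f x - h x) = ip k f - ip k h.
Proof.
move=> f2 h2 k2; have := ip_linr (-1) h2 f2 k2.
by under eq_fun do rewrite mulN1r addrC; rewrite rmorphN1 mulN1r addrC.
Qed.

Lemma ip0l k : L2 k -> ip (fun=> 0) k = 0.
Proof.
move=> k2; have -> : (fun=> 0) = (fun x => k x - k x) :> fn.
  by apply/funext => x; rewrite subrr.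
by rewrite ip_subl// subrr.
Qed.

Lemma L2_sum (I : choiceType) (s : seq I) (b : I -> R[i]) (e : I -> fn) :
  {in s, forall i, L2 (e i)} -> L2 (fun x => \sum_(i <- s) b i * e i x).
Proof.
elim: s => [|i s IH] hs; first by under eq_fun do rewrite big_nil; exact: L2_0.
under eq_fun do rewrite big_cons; apply: L2_lin; first exact/hs/mem_head.
by apply: IH => j js; apply: hs; rewrite in_cons js orbT.
Qed.

Lemma ip_suml (I : choiceType) (s : seq I) (b : I -> R[i]) (e : I -> fn) k :
  {in s, forall i, L2 (e i)} -> L2 k ->
  ip (fun x => \sum_(i <- s) b i * e i x) k = \sum_(i <- s) b i * ip (e i) k.
Proof.
move=> + k2; elim: s => [|i s IH] hs.
  by under eq_fun do rewrite big_nil; rewrite big_nil ip0l.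
have hs' : {in s, forall i, L2 (e i)}.
  by move=> j js; apply: hs; rewrite in_cons js orbT.
under eq_fun do rewrite big_cons; rewrite big_cons ip_linl ?IH//.
  exact/hs/mem_head.
exact: L2_sum.
Qed.

Lemma ip_sumr (I : choiceType) (s : seq I) (b : I -> R[i]) (e : I -> fn) k :
  {in s, forall i, L2 (e i)} -> L2 k ->
  ip k (fun x => \sum_(i <- s) b i * e i x) =
  \sum_(i <- s) conjc (b i) * ip k (e i).
Proof.
move=> hs k2; rewrite ip_conj//; last exact: L2_sum.
rewrite ip_suml// rmorph_sum/=; apply: eq_big_seq => i si.
by rewrite rmorphM/= (ip_conj k2 (hs _ si)).
Qed.

Definition sqL2norm f : R := complex.Re (ip f f).

Lemma sqL2norm_ge0 f : 0 <= sqL2norm f.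
Proof.
apply: Rintegral_ge0 => x _; case: (f x) => p q /=.
by rewrite mulrN opprK addr_ge0// -expr2 sqr_ge0.
Qed.

Lemma ip_sqL2norm f : L2 f -> ip f f = (sqL2norm f)%:C.
Proof.
move=> f2; have := ip_conj f2 f2; rewrite /sqL2norm.
case: (ip f f) => p q [] /= /eqP; rewrite -subr_eq0 opprK -mulr2n mulrn_eq0/=.
by move=> /eqP ->.
Qed.

Lemma sqL2norm_lin z f h : L2 f -> L2 h ->
  (sqL2norm (fun x => z * f x + h x))%:C =
  z * conjc z * (sqL2norm f)%:C + (z * ip f h + conjc (z * ip f h)) + (sqL2norm h)%:C.
Proof.
move=> f2 h2; have zf := L2_lin z f2 h2.
rewrite -!ip_sqL2norm// ip_linl// !ip_linr// (ip_conj h2 f2).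
have -> : conjc (z * ip f h) = conjc z * conjc (ip f h) by rewrite rmorphM.
ring.
Qed.

(** The squared norm of [t f + h] is a nonnegative quadratic polynomial in [t]. The
    real part suffices below, since a phase can always be put into [h]. *)
Lemma cauchy_schwarz f h : L2 f -> L2 h ->
  complex.Re (ip f h) <= L2norm f * L2norm h.
Proof.
move=> f2 h2; set b := complex.Re _.
have quad (t : R) : 0 <= t ^+ 2 * sqL2norm f + 2 * t * b + sqL2norm h.
  apply: le_trans (sqL2norm_ge0 (fun x => t%:C * f x + h x)) _.
  rewrite le_eqVlt; apply/orP; left; apply/eqP; apply: complexI.
  rewrite sqL2norm_lin// /b; case: (ip f h) => p q.
  by simpc; apply/eqP; rewrite eq_complex/=; apply/andP; split; apply/eqP; ring.
rewrite /L2norm -/(sqL2norm f) -/(sqL2norm h).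
have [f0|f0] := eqVneq (sqL2norm f) 0.
  rewrite f0 sqrtr0 mul0r leNgt; apply/negP => b0.
  (* a nonconstant affine function takes a negative value, here -1 *)
  have := quad (- (sqL2norm h + 1) / (2 * b)).
  have bn : b != 0 by rewrite gt_eqF.
  rewrite f0 (_ : _ + sqL2norm h = -1); first by move=> ?; lra.
  by field.
have fp : 0 < sqL2norm f by rewrite lt_neqAle eq_sym f0 sqL2norm_ge0.
rewrite -sqrtrM ?sqL2norm_ge0//; apply: (le_trans (ler_norm _)).
rewrite -sqrtr_sqr ler_wsqrtr//.
(* the minimum of the quadratic polynomial *)
have := quad (- b / sqL2norm f).
rewrite -(ler_pM2r fp) mul0r.
have -> : ((- b / sqL2norm f) ^+ 2 * sqL2norm f + 2 * (- b / sqL2norm f) * b + sqL2norm h) *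
    sqL2norm f = sqL2norm f * sqL2norm h - b ^+ 2 by field.
by rewrite subr_ge0.
Qed.

Lemma L2norm_triangle f h k : L2 f -> L2 h -> L2 k ->
  L2norm (fun x => f x - h x) <=
  L2norm (fun x => f x - k x) + L2norm (fun x => k x - h x).
Proof.
move=> f2 h2 k2; set p : fn := fun x => f x - k x; set q : fn := fun x => k x - h x.
have p2 : L2 p by exact: L2_sub.
have q2 : L2 q by exact: L2_sub.
have -> : (fun x => f x - h x) = (fun x => 1 * p x + q x).
  by apply/funext => x; rewrite /p /q mul1r addrA subrK.
have n0 g : 0 <= L2norm (g : fn) by exact: sqrtr_ge0.
rewrite -[leRHS]ger0_norm ?addr_ge0// -sqrtr_sqr ler_wsqrtr// -/(sqL2norm _).
have -> : sqL2norm (fun x => 1 * p x + q x) =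
    sqL2norm p + 2 * complex.Re (ip p q) + sqL2norm q.
  apply: complexI; rewrite sqL2norm_lin//; case: (ip p q) => ? ?.
  by simpc; apply/eqP; rewrite eq_complex/=; apply/andP; split; apply/eqP; ring.
have := cauchy_schwarz p2 q2.
have : L2norm p ^+ 2 = sqL2norm p by rewrite sqr_sqrtr// sqL2norm_ge0.
have : L2norm q ^+ 2 = sqL2norm q by rewrite sqr_sqrtr// sqL2norm_ge0.
by move=> <- <-; nra.
Qed.

End hilbert.

(** * Closed spans of orthonormal families *)

Section closures.
Context {R : realType} (d : nat).
Local Notation fn := ('cV[R]_d -> R[i]).
Implicit Types (f h k : fn) (V W : set fn) (z : R[i]).

Lemma sub_L2closure W : W `<=` @L2 R d -> W `<=` L2closure W.
Proof.
move=> WL f Wf; split; first exact: WL.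
move=> e e0; exists f => //; suff -> : L2norm (fun x => f x - f x) = 0 by [].
rewrite /L2norm ip_subl; [|exact: WL|exact: WL|apply: L2_sub; exact: WL].
by rewrite subrr sqrtr0.
Qed.

(** Orthogonality passes to limits by the Cauchy-Schwarz inequality, applied to the
    multiple [w k] of [k], whose inner product with [f] is the real number [|w|^2]. *)
Lemma ip_L2closure_eq0 W f k : W `<=` @L2 R d -> L2 k ->
  (forall h, W h -> ip h k = 0) -> L2closure W f -> ip f k = 0.
Proof.
move=> WL k2 Wk [f2 fW]; set w := ip f k.
pose k' : fn := fun x => w * k x + 0.
have k'2 : L2 k' by apply: L2_lin => //; exact: L2_0.
have ipk' h : L2 h -> ip h k' = conjc w * ip h k.
  move=> h2; rewrite /k' (ip_linr w k2 (@L2_0 R d) h2).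
  by rewrite (ip_conj h2 (@L2_0 R d)) ip0l// rmorph0 addr0.
apply/eqP; apply: contraT => w0.
have wp : 0 < complex.Re (conjc w * w).
  have : 0 < conjc w * w by rewrite mulrC -normCK exprn_gt0// normr_gt0.
  by rewrite ltcE => /andP[].
have np : 0 < L2norm k' + 1 by rewrite ltr_wpDl// sqrtr_ge0.
have [h Wh hf] := fW _ (divr_gt0 wp np).
have h2 := WL _ Wh.
have := cauchy_schwarz (L2_sub f2 h2) k'2.
rewrite ip_subl// !ipk'// (Wk _ Wh) mulr0 subr0 -/w => hle.
have : complex.Re (conjc w * w) < complex.Re (conjc w * w).
  apply: (le_lt_trans hle).
  have : L2norm (fun x => f x - h x) * L2norm k' <=
      L2norm (fun x => f x - h x) * (L2norm k' + 1).
    by rewrite ler_wpM2l ?sqrtr_ge0// lerDl.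
  by move=> /le_lt_trans; apply; rewrite -ltr_pdivlMr.
by rewrite ltxx.
Qed.

Definition linear_subspace W :=
  [/\ W `<=` @L2 R d, W (fun=> 0) &
    forall z f h, W f -> W h -> W (fun x => z * f x + h x)].

Lemma L2norm_lin_le z f h : L2 f -> L2 h ->
  L2norm (fun x => z * f x + h x) <= complex.Re `|z| * L2norm f + L2norm h.
Proof.
move=> f2 h2.
have zf : L2 (fun x => z * f x + 0) by apply: L2_lin => //; exact: L2_0.
have h2N : L2 (fun x => 0 - h x) by apply: L2_sub => //; exact: L2_0.
have := L2norm_triangle zf h2N (@L2_0 R d).
have -> : (fun x => z * f x + 0 - (0 - h x)) = (fun x => z * f x + h x).
  by apply/funext => x; rewrite addr0 sub0r opprK.
have -> : (fun x => (0 : R[i]) - (0 - h x)) = h.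
  by apply/funext => x; rewrite sub0r opprB subr0.
move=> /le_trans; apply; rewrite lerD2r le_eqVlt; apply/orP; left; apply/eqP.
have -> : (fun x => z * f x + 0 - 0) = (fun x => z * f x + 0).
  by apply/funext => x; rewrite subr0.
have zr : `|z| = (complex.Re `|z|)%:C by rewrite normc_def.
have z0 : 0 <= complex.Re `|z| by rewrite normc_def /= sqrtr_ge0.
rewrite /L2norm -!/(sqL2norm _) -[in RHS](ger0_norm z0) -sqrtr_sqr -sqrtrM ?sqr_ge0//.
congr Num.sqrt; apply: complexI; rewrite sqL2norm_lin//; last exact: L2_0.
have -> : z * conjc z = ((complex.Re `|z|) ^+ 2)%:C by rewrite rmorphXn /= -zr normCK.
rewrite (ip_conj f2 (@L2_0 R d)) ip0l// rmorph0 mulr0 rmorph0 addr0.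
rewrite [sqL2norm (fun=> 0)]/sqL2norm ip0l; last exact: L2_0.
by rewrite !addr0 -!rmorphM.
Qed.

Lemma L2closure_linear_subspace W : linear_subspace W ->
  closed_subspace (L2closure W).
Proof.
move=> [WL W0 Wl]; split.
- by move=> f [].
- by apply: sub_L2closure.
- move=> z f h [f2 fW] [h2 hW]; split; first exact: L2_lin.
  move=> e e0; set c := complex.Re `|z|.
  have c0 : 0 <= c by rewrite /c normc_def /= sqrtr_ge0.
  have c1 : 0 < c + 1 by rewrite ltr_wpDl.
  have e2 : 0 < e / 2 by rewrite divr_gt0.
  have [f' Wf' ff'] := fW _ (divr_gt0 e2 c1).
  have [h' Wh' hh'] := hW _ e2.
  exists (fun x => z * f' x + h' x); first exact: Wl.
  rewrite (_ : (fun x => _) = (fun x => z * (f x - f' x) + (h x - h' x))); last first.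
    by apply/funext => x; ring.
  apply: le_lt_trans (L2norm_lin_le _ (L2_sub f2 (WL _ Wf')) (L2_sub h2 (WL _ Wh'))) _.
  rewrite -/c [ltRHS]splitr ler_ltD//.
  move: ff'; rewrite ltr_pdivlMr// => /ltW; apply: le_trans.
  by rewrite mulrC ler_wpM2l ?sqrtr_ge0// lerDl.
- move=> f [f2 fW]; split=> // e e0.
  have e2 : 0 < e / 2 by rewrite divr_gt0.
  have [h [h2 hW] fh] := fW _ e2.
  have [k Wk hk] := hW _ e2.
  exists k => //; apply: le_lt_trans (L2norm_triangle f2 (WL _ Wk) h2) _.
  by rewrite [ltRHS]splitr ltrD.
Qed.

Lemma L2closure_sub V W : closed_subspace V -> W `<=` V -> L2closure W `<=` V.
Proof.
move=> [VL _ _ Vc] WV f [f2 fW]; apply: Vc; split=> // e e0.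
by have [h Wh ?] := fW _ e0; exists h => //; exact: WV.
Qed.

Section spans.
Context {I : choiceType}.
Implicit Types (D : set I) (e : I -> fn).

Lemma lin_span_subspace D e : (forall i, D i -> L2 (e i)) ->
  linear_subspace (lin_span D e).
Proof.
move=> e2; split.
- move=> f [A [b [AD ->]]]; apply: L2_sum => i iA; exact/e2/AD.
- exists fset0, (fun=> 0); split; first by move=> i.
  by apply/funext => x; rewrite big_nil.
- move=> z f h [A [b [AD ->]]] [A' [b' [AD' ->]]].
  exists (A `|` A')%fset, (fun i => z * (if i \in A then b i else 0) +
    (if i \in A' then b' i else 0)); split.
    by move=> i /=; rewrite in_fsetU => /orP[/AD|/AD'].
  apply/funext => x.
  under [in RHS]eq_bigr do rewrite mulrDl -mulrA.
  rewrite big_split/= -mulr_sumr; congr (_ * _ + _).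
    rewrite -(big_fset_incl _ (fsubsetUl A A')) /=; last first.
      by move=> i _ /negbTE ->; rewrite mul0r.
    by apply: eq_big_seq => i ->.
  rewrite -(big_fset_incl _ (fsubsetUr A A')) /=; last first.
    by move=> i _ /negbTE ->; rewrite mul0r.
  by apply: eq_big_seq => i ->.
Qed.

Lemma mem_lin_span D e i : D i -> lin_span D e (e i).
Proof.
move=> Di; exists [fset i]%fset, (fun=> 1); split.
  by move=> j /=; rewrite inE => /eqP ->.
by apply/funext => x; rewrite big_seq_fset1 mul1r.
Qed.

Lemma closed_subspace_sum V (s : seq I) (b : I -> R[i]) e : closed_subspace V ->
  {in s, forall i, V (e i)} -> V (fun x => \sum_(i <- s) b i * e i x).
Proof.
move=> [_ V0 Vl _]; elim: s => [|i s IH] hs.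
  by under eq_fun do rewrite big_nil.
under eq_fun do rewrite big_cons; apply: Vl; first exact/hs/mem_head.
by apply: IH => j js; apply: hs; rewrite in_cons js orbT.
Qed.

Lemma L2closure_span_sub V D e : closed_subspace V -> (forall i, D i -> V (e i)) ->
  L2closure (lin_span D e) `<=` V.
Proof.
move=> cV De; apply: L2closure_sub => // f [A [b [AD ->]]].
by apply: closed_subspace_sum => // i iA; exact/De/AD.
Qed.

Lemma ip_orthonormal_sum (D : set I) e (A : {fset I}) (b b' : I -> R[i]) :
  (forall i, D i -> L2 (e i)) -> orthonormal_family D e -> [set` A] `<=` D ->
  ip (fun x => \sum_(i <- A) b i * e i x) (fun x => \sum_(i <- A) b' i * e i x)
  = \sum_(i <- A) b i * conjc (b' i).
Proof.
move=> e2 one AD.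
have hA : {in A, forall i, L2 (e i)} by move=> i iA; exact/e2/AD.
rewrite ip_suml//; last exact: L2_sum.
apply: eq_big_seq => i iA; rewrite ip_sumr//; last exact: hA.
rewrite (big_fsetD1 i)//= one; [|exact: AD|exact: AD].
rewrite eqxx mulr1 big1_fset ?addr0// => j; rewrite in_fsetD1 => /andP[ji jA] _.
by rewrite one; [rewrite eq_sym (negbTE ji) mulr0|exact: AD|exact: AD].
Qed.

(** The squared distance from [f] to its orthogonal projection is the defect in
    Bessel's inequality. *)
Lemma parseval_span (D : set I) e (A : {fset I}) f :
  (forall i, D i -> L2 (e i)) -> orthonormal_family D e -> [set` A] `<=` D ->
  L2 f -> ip f f = \sum_(i <- A) ip f (e i) * conjc (ip f (e i)) ->
  L2closure (lin_span D e) f.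
Proof.
move=> e2 one AD f2 fA.
have hA : {in A, forall i, L2 (e i)} by move=> i iA; exact/e2/AD.
pose s : fn := fun x => \sum_(i <- A) ip f (e i) * e i x.
have s2 : L2 s by exact: L2_sum.
suff n0 : sqL2norm (fun x => f x - s x) = 0.
  split=> // eps eps0; exists s; last by rewrite /L2norm -/(sqL2norm _) n0 sqrtr0.
  by exists A, (fun i => ip f (e i)).
rewrite /sqL2norm ip_subl//; last exact: L2_sub.
rewrite !ip_subr// /s (ip_orthonormal_sum _ _ e2 one AD) ip_suml// ip_sumr// fA.
rewrite (_ : complex.Re _ = complex.Re 0)//; congr complex.Re.
apply/eqP; rewrite subr_eq0; apply/eqP.
rewrite -!sumrB; apply: eq_big_seq => i iA.
rewrite -(ip_conj (hA _ iA) f2).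
by rewrite mulrC.
Qed.

End spans.

(** Removing the [D0]-part from an approximant of a vector orthogonal to [V0] only
    improves the approximation, by Pythagoras. That the [D0]-part of the family is
    complete in [V0] is assumed in its dual form, a vector orthogonal to the family
    being orthogonal to [V0]; this form does not depend on how the family is
    indexed. *)
Lemma orthocomplement_span (I : choiceType) (D0 D1 : set I) (e : I -> fn) V0 V1 :
  closed_subspace V1 ->
  (forall i, D0 i \/ D1 i -> V1 (e i)) ->
  orthonormal_family (D0 `|` D1) e ->
  D0 `&` D1 = set0 ->
  (forall i, D0 i -> V0 (e i)) ->
  (forall k h, L2 k -> (forall i, D0 i -> ip (e i) k = 0) -> V0 h -> ip h k = 0) ->
  V1 `<=` L2closure (lin_span (D0 `|` D1) e) ->
  V0 `<=` V1 ->
  L2closure (lin_span D1 e) = orthocomplement V1 V0.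
Proof.
move=> cV1 eV1 one D01 eV0 orth sp V01.
have [V1L V10 V1l V1c] := cV1.
have e2 i : D0 i \/ D1 i -> L2 (e i) by move=> /eV1/V1L.
have dis i : D0 i -> D1 i -> False.
  by move=> a b; have : (D0 `&` D1) i by []; rewrite D01.
apply/seteqP; split=> f.
  move=> fcl; have V1f : V1 f.
    by apply: L2closure_span_sub fcl => // i D1i; apply: eV1; right.
  split=> // h V0h; have f2 := V1L _ V1f; have h2 := V1L _ (V01 _ V0h).
  apply: (ip_L2closure_eq0 _ h2 _ fcl).
    by move=> k [A [b [AD ->]]]; apply: L2_sum => i iA; apply: e2; right; exact: AD.
  move=> k [A [b [AD ->]]].
  have hA : {in A, forall i, L2 (e i)}.
    by move=> i iA; apply: e2; right; exact: AD.
  rewrite ip_suml// big1_seq// => i /andP[_ iA].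
  rewrite (ip_conj (hA _ iA) h2) orth ?rmorph0 ?mulr0//; first exact: hA.
  move=> j D0j; rewrite one; [|by left|by right; exact: AD].
  by case: eqP => // ji; case: (dis i); [rewrite -ji|exact: AD].
move=> [V1f fV0]; have f2 := V1L _ V1f; split=> // eps eps0.
have [_ /(_ _ eps0) [_ [A [b [AD ->]]] fs]] := sp _ V1f.
pose A0 := [fset i in A | `[< D0 i >]]%fset.
pose A1 := [fset i in A | ~~ `[< D0 i >]]%fset.
pose p : fn := fun x => \sum_(i <- A0) b i * e i x.
pose q : fn := fun x => \sum_(i <- A1) b i * e i x.
have A0D i : i \in A0 -> D0 i by rewrite !inE => /andP[_ /asboolP].
have A1D i : i \in A1 -> D1 i.
  by rewrite !inE => /andP[iA /asboolPn nD]; case: (AD _ iA).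
have p2 : L2 p by apply: L2_sum => i /A0D ?; apply: e2; left.
have q2 : L2 q by apply: L2_sum => i /A1D ?; apply: e2; right.
have sE : (fun x => f x - \sum_(i <- A) b i * e i x) = (fun x => (f x - q x) - p x).
  apply/funext => x; rewrite (big_fsetID _ (fun i => `[< D0 i >]))/=.
  by rewrite -/(p x) -/(q x) opprD addrA addrAC.
exists q; first by exists A1, b; split=> // i /A1D.
move: fs; rewrite sE; apply: le_lt_trans; rewrite ler_wsqrtr//.
have fqp : ip (fun x => f x - q x) p = 0.
  rewrite ip_subl//.
  rewrite /p ip_sumr//; last by move=> i /A0D ?; apply: e2; left.
  rewrite ip_sumr//; last by move=> i /A0D ?; apply: e2; left.
  rewrite big1_seq ?sub0r; last first.
    by move=> i /andP[_ /A0D ?]; rewrite fV0 ?mulr0//; exact: eV0.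
  rewrite big1_seq ?oppr0// => i /andP[_ /A0D D0i].
  rewrite /q ip_suml; [|by move=> j /A1D ?; apply: e2; right|by apply: e2; left].
  rewrite big1_seq ?mulr0// => j /andP[_ /A1D D1j].
  rewrite one; [|by right|by left].
  by case: eqP => [ji|]; rewrite ?mulr0//; case: (dis i); rewrite -?ji// ji.
have fq2 := L2_sub f2 q2.
rewrite (ip_subl fq2 p2 (L2_sub fq2 p2)) (ip_subr fq2 p2 fq2) (ip_subr fq2 p2 p2).
rewrite fqp subr0.
rewrite (ip_conj p2 fq2) fqp rmorph0 sub0r opprK.
have := sqL2norm_ge0 p; rewrite /sqL2norm; case: (ip p p) (ip _ _) => ? ? [? ?] /=.
by rewrite lerDl.
Qed.

End closures.

(** * Affine maps and dilations *)

Section affine_group.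
Context {R : realType} (d : nat).
Implicit Types (u v w : aff R d) (x : 'cV[R]_d).

Lemma aff_app_comp u v x : aff_app (aff_comp u v) x = aff_app u (aff_app v x).
Proof. by rewrite /aff_app /aff_comp /= mulmxDr mulmxA addrA. Qed.

Lemma aff_compA u v w : aff_comp u (aff_comp v w) = aff_comp (aff_comp u v) w.
Proof. by rewrite /aff_comp /= !mulmxA mulmxDr !mulmxA addrA. Qed.

Lemma aff_comp1l u : aff_comp (translation 0) u = u.
Proof. by case: u => A t; rewrite /aff_comp /= !mul1mx addr0. Qed.

Lemma aff_comp1r u : aff_comp u (translation 0) = u.
Proof. by case: u => A t; rewrite /aff_comp /= mulmx1 mulmx0 add0r. Qed.

Lemma aff_compVr u : u.1 \in unitmx -> aff_comp u (aff_inv u) = translation 0.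
Proof.
move=> uu; rewrite /aff_comp /aff_inv /translation /= mulmxV// mulmxN mulmxA.
by rewrite mulmxV// mul1mx addNr.
Qed.

Lemma aff_compVl u : u.1 \in unitmx -> aff_comp (aff_inv u) u = translation 0.
Proof.
by move=> uu; rewrite /aff_comp /aff_inv /translation /= mulVmx// subrr.
Qed.

Lemma aff_compKl u v : u.1 \in unitmx -> aff_comp (aff_inv u) (aff_comp u v) = v.
Proof. by move=> uu; rewrite aff_compA aff_compVl// aff_comp1l. Qed.

Lemma aff_compVKl u v : u.1 \in unitmx -> aff_comp u (aff_comp (aff_inv u) v) = v.
Proof. by move=> uu; rewrite aff_compA aff_compVr// aff_comp1l. Qed.

Lemma aff_inv_unit u : u.1 \in unitmx -> (aff_inv u).1 \in unitmx.
Proof. by rewrite /= unitmx_inv. Qed.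

Lemma aff_comp_unit u v :
  u.1 \in unitmx -> v.1 \in unitmx -> (aff_comp u v).1 \in unitmx.
Proof. by rewrite /= unitmx_mul => -> ->. Qed.

Lemma aff_inv_uniq u v : u.1 \in unitmx -> aff_comp u v = translation 0 -> v = aff_inv u.
Proof. by move=> uu e; rewrite -(aff_compKl v uu) e aff_comp1r. Qed.

Lemma aff_inv_comp u v : u.1 \in unitmx -> v.1 \in unitmx ->
  aff_inv (aff_comp u v) = aff_comp (aff_inv v) (aff_inv u).
Proof.
move=> uu uv; apply/esym/aff_inv_uniq; first exact: aff_comp_unit.
by rewrite -aff_compA aff_compVKl// aff_compVr.
Qed.

Lemma aff_invK u : u.1 \in unitmx -> aff_inv (aff_inv u) = u.
Proof.
move=> uu; apply/esym/aff_inv_uniq; first exact: aff_inv_unit.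
exact: aff_compVl.
Qed.

Lemma dotvE x y : dotv x y = (x^T *m y) ord0 ord0.
Proof. by rewrite mxE; apply: eq_bigr => i _; rewrite mxE. Qed.

Lemma dotv_ge0 x : 0 <= dotv x x.
Proof. by apply: sumr_ge0 => i _; rewrite -expr2 sqr_ge0. Qed.

(** Polarization: it is enough to evaluate the form at the basis vectors and at their
    pairwise sums. *)
Lemma symmetric_form_eq0 (S : 'M[R]_d) : S^T = S ->
  (forall x, (x^T *m S *m x) ord0 ord0 = 0) -> S = 0.
Proof.
move=> SS q0.
have sym i j : S i j = S j i by rewrite -[in RHS]SS mxE.
have e (i j : 'I_d) :
    ((delta_mx i 0 : 'cV[R]_d)^T *m S *m (delta_mx j 0 : 'cV[R]_d)) ord0 ord0 = S i j.
  by rewrite trmx_delta -rowE -colE !mxE.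
have diag i : S i i = 0 by rewrite -e q0.
apply/matrixP => i j; rewrite [RHS]mxE.
have := q0 (delta_mx i 0 + delta_mx j 0).
have mD (M N : 'M[R]_1) : (M + N) ord0 ord0 = M ord0 ord0 + N ord0 ord0.
  by rewrite mxE.
rewrite [_^T]linearD /= mulmxDr !mulmxDl !mD !e !diag (sym j i) addr0 add0r -mulr2n.
by move=> /eqP; rewrite mulrn_eq0 /= => /eqP.
Qed.

Lemma isometry_orthogonal u : aff_isometry u -> u.1^T *m u.1 = 1%:M.
Proof.
case: u => A t iso /=; apply/eqP; rewrite -subr_eq0; apply/eqP.
apply: symmetric_form_eq0 => [|x].
  by rewrite linearB /= trmx_mul trmxK trmx1.
have : dotv (A *m x) (A *m x) = dotv x x.
  have := iso x 0; rewrite /aff_app /= mulmx0 add0r addrK subr0 /enorm.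
  by move=> /(congr1 (fun z => z ^+ 2)); rewrite !sqr_sqrtr ?dotv_ge0.
rewrite !dotvE trmx_mul => /eqP; rewrite -subr_eq0 => /eqP <-.
by rewrite mulmxBr mulmxBl mulmx1 !mulmxA !mxE.
Qed.

Lemma isometry_det u : aff_isometry u -> `|\det u.1| = 1.
Proof.
move=> /isometry_orthogonal /(congr1 determinant).
rewrite det_mulmx det_tr det1 -expr2 => /eqP.
by rewrite sqrf_eq1 => /orP[] /eqP ->; rewrite ?normrN normr1.
Qed.

Lemma isometry_unit u : aff_isometry u -> u.1 \in unitmx.
Proof.
by move=> /isometry_det; rewrite unitmxE unitfE -normr_eq0 => ->; exact: oner_neq0.
Qed.

End affine_group.

Section dilations.
Context {R : realType} (d : nat).
Local Notation leb := (@lebesgue_cV R d).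
Local Notation fn := ('cV[R]_d -> R[i]).
Implicit Types (f h k : fn) (u v w : aff R d).

Lemma dilate_lin u (z : R[i]) f h :
  dilate u (fun x => z * f x + h x) =
  (fun x => z * dilate u f x + dilate u h x).
Proof. by apply/funext => x; rewrite /dilate mulrDr mulrCA. Qed.

Lemma dilate_sum u (I : Type) (s : seq I) (b : I -> R[i]) (e : I -> fn) :
  dilate u (fun x => \sum_(i <- s) b i * e i x) =
  (fun x => \sum_(i <- s) b i * dilate u (e i) x).
Proof.
by apply/funext => x; rewrite /dilate mulr_sumr; apply: eq_bigr => i _; rewrite mulrCA.
Qed.

Lemma dilate_comp u v f : u.1 \in unitmx -> v.1 \in unitmx ->
  dilate u (dilate v f) = dilate (aff_comp u v) f.
Proof.
move=> uu uv; apply/funext => x.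
rewrite /dilate aff_inv_comp// aff_app_comp mulrA -rmorphM/= -invfM.
by rewrite det_mulmx normrM sqrtrM.
Qed.

Lemma dilate1 f : dilate (translation 0) f = f.
Proof.
apply/funext => x; rewrite /dilate /= det1 normr1 sqrtr1 invr1 mul1r.
by rewrite /aff_app/= invmx1 !mul1mx subr0.
Qed.

Lemma measurable_comp_affine u (v : 'cV[R]_d -> R) :
  measurable_fun [set: 'cV[R]_d] v ->
  measurable_fun [set: 'cV[R]_d] (fun x => v (aff_app u x)).
Proof. by move=> mv; exact: (measurableT_comp mv (measurable_affine_cV _ _)). Qed.

Lemma Lfun2_comp_affine u (v : 'cV[R]_d -> R) : u.1 \in unitmx ->
  v \in Lfun leb 2%:E -> (fun x => v (aff_app u x)) \in Lfun leb 2%:E.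
Proof.
move=> uu /Lfun2P[mv iv]; apply/Lfun2P; split; first exact: measurable_comp_affine.
exact: (integrable_affine_cV u.2 uu iv).
Qed.

Lemma L2_comp_affine u f : u.1 \in unitmx -> L2 f ->
  L2 (fun x => f (aff_app u x)).
Proof.
move=> uu [rf imf]; split.
  exact: (Lfun2_comp_affine uu rf).
exact: (Lfun2_comp_affine uu imf).
Qed.

Lemma L2_scale z f : L2 f -> L2 (fun x => z * f x).
Proof.
move=> f2; have := L2_lin z f2 (@L2_0 R d).
by under eq_fun do rewrite addr0.
Qed.

Lemma L2_dilate u f : u.1 \in unitmx -> L2 f -> L2 (dilate u f).
Proof.
by move=> uu f2; apply/L2_scale/L2_comp_affine => //; exact: aff_inv_unit.
Qed.

Lemma Rintegral_comp_affine u (v : 'cV[R]_d -> R) : u.1 \in unitmx ->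
  leb.-integrable [set: 'cV[R]_d] (EFin \o v) ->
  (\int[leb]_x v (aff_app u x) = `|\det u.1|^-1 * \int[leb]_x v x)%R.
Proof.
move=> uu iv; rewrite /Rintegral.
have := integral_affine_cV u.2 uu iv; rewrite /aff_app /= => ->.
by rewrite fineM//; exact: (integrable_fin_num measurableT iv).
Qed.

(** The factor in [dilate] compensates the Jacobian of the change of variables. *)
Lemma ip_dilate u f h : u.1 \in unitmx -> L2 f -> L2 h ->
  ip (dilate u f) (dilate u h) = ip f h.
Proof.
move=> uu f2 h2; set s : R := (Num.sqrt `|\det u.1|)^-1.
have ui := aff_inv_unit uu.
have E : (fun x => dilate u f x * conjc (dilate u h x)) =
   (fun x => (s ^+ 2)%:C * (f (aff_app (aff_inv u) x) * conjc (h (aff_app (aff_inv u) x)))).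
  apply/funext => x; rewrite /dilate -/s.
  have -> H : conjc (s%:C * H) = s%:C * conjc H by rewrite rmorphM /= oppr0.
  by rewrite rmorphXn; ring.
have [ir ii] := L2_mul f2 h2.
rewrite !ipE E /cintegral.
have s2 : s ^+ 2 * `|\det (invmx u.1)|^-1 = 1.
  rewrite /s exprVn sqr_sqrtr// det_inv normfV invrK mulVf// normr_eq0.
  by rewrite -unitfE -unitmxE.
have [jr ji] := (integrable_affine_cV (aff_inv u).2 ui ir,
                 integrable_affine_cV (aff_inv u).2 ui ii).
congr (_ +i* _).
  rewrite -[RHS]mul1r -s2 -mulrA -(Rintegral_comp_affine ui ir) -RintegralZl//.
  congr Rintegral; apply/funext => x.
  by case: (_ * conjc _) => p q /=; rewrite mul0r subr0.
rewrite -[RHS]mul1r -s2 -mulrA -(Rintegral_comp_affine ui ii) -RintegralZl//.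
congr Rintegral; apply/funext => x.
by case: (_ * conjc _) => p q /=; rewrite mul0r addr0.
Qed.

Lemma L2norm_dilate u f : u.1 \in unitmx -> L2 f -> L2norm (dilate u f) = L2norm f.
Proof. by move=> uu f2; rewrite /L2norm ip_dilate. Qed.

Lemma closed_subspace_ae (V : set fn) f h : closed_subspace V -> V f -> L2 h ->
  {ae leb, forall x, f x = h x} -> V h.
Proof.
move=> [VL _ _ Vc] Vf h2 fh; have f2 := VL _ Vf.
apply: Vc; split=> // e e0; exists f => //.
have z2 := @L2_0 R d.
rewrite /L2norm (@ip_ae _ _ _ (fun=> 0) _ (fun=> 0)) ?ip0l ?sqrtr0//;
  try exact: L2_sub.
  by apply: filterS fh => x ->; rewrite subrr.
by apply: filterS fh => x ->; rewrite subrr.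
Qed.

End dilations.

(** * Sums of finite support *)

Section finite_support_sums.
Context {V : zmodType} {I : choiceType}.
Implicit Types (P : set I) (F : I -> V) (A : {fset I}).

(** A sum over a set is zero by convention when its terms have infinite support, so
    every exchange or splitting of sums below has to carry this condition. *)
Definition finsupp_on P F := finite_set (P `&` [set i | F i != 0]).

Lemma fsbig_cover P F A : [set` A] `<=` P ->
  (forall i, P i -> i \notin A -> F i = 0) ->
  \sum_(i \in P) F i = \sum_(i <- A) F i.
Proof.
move=> AP FA; rewrite -(fsbig_widen [set` A] P)//; last first.
  by move=> i [Pi /negP iA] /=; apply: FA.
by rewrite -fsbig_seq.
Qed.

Lemma finsupp_cover_seq P (T : eqType) (s : seq T) (F : T -> I -> V) :
  {in s, forall t, finsupp_on P (F t)} ->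
  exists2 A : {fset I}, [set` A] `<=` P &
    forall t i, t \in s -> P i -> i \notin A -> F t i = 0.
Proof.
elim: s => [|t s IH] hs; first by exists fset0.
have [|A AP FA] := IH; first by move=> t' t's; apply: hs; rewrite in_cons t's orbT.
have ft := hs t (mem_head _ _).
exists (A `|` fset_set (P `&` [set i | F t i != 0]))%fset.
  by move=> i /=; rewrite in_fsetU in_fset_set// => /orP[/AP//|/set_mem[]].
move=> t' i; rewrite in_cons in_fsetU negb_or => /orP[/eqP ->|t's] Pi /andP[iA].
  rewrite in_fset_set// => Ni.
  by apply/eqP; apply: contraNT Ni => Fi; apply: mem_set.
by move=> _; exact: FA iA.
Qed.

Lemma finsupp_cover P F : finsupp_on P F ->
  exists2 A : {fset I}, [set` A] `<=` P & forall i, P i -> i \notin A -> F i = 0.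
Proof.
move=> fF; have [|A AP FA] := @finsupp_cover_seq P unit [:: tt] (fun=> F).
  by move=> t _.
by exists A => // i; exact: (FA tt).
Qed.

Lemma finsupp_onP P F A : (forall i, P i -> i \notin A -> F i = 0) -> finsupp_on P F.
Proof.
move=> FA; apply: (sub_finite_set _ (finite_fset A)) => i [Pi /= Fi].
by apply: contraNT Fi => iA; rewrite FA.
Qed.

Lemma exchange_fsbig_seq P (T : eqType) (s : seq T) (F : T -> I -> V) :
  {in s, forall t, finsupp_on P (F t)} ->
  \sum_(i \in P) \sum_(t <- s) F t i = \sum_(t <- s) \sum_(i \in P) F t i.
Proof.
move=> /finsupp_cover_seq[A AP FA].
rewrite (fsbig_cover AP); last first.
  by move=> i Pi iA; rewrite big1_seq// => t /andP[_ ts]; exact: FA iA.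
rewrite exchange_big; apply: eq_big_seq => t ts.
by rewrite (fsbig_cover AP)// => i Pi iA; exact: FA iA.
Qed.

Lemma finsupp_sum P (T : eqType) (s : seq T) (F : T -> I -> V) :
  {in s, forall t, finsupp_on P (F t)} ->
  finsupp_on P (fun i => \sum_(t <- s) F t i).
Proof.
move=> /finsupp_cover_seq[A AP FA]; apply: (@finsupp_onP _ _ A) => i Pi iA.
by rewrite big1_seq// => t /andP[_ ts]; exact: FA iA.
Qed.

End finite_support_sums.

Section finite_support_reindex.
Context {V : zmodType} {I J : choiceType}.

Lemma finsupp_bij (P : set I) (Q : set J) (f : I -> J) (F : J -> V) :
  set_inj P f -> (forall i, P i -> Q (f i)) ->
  finsupp_on Q F -> finsupp_on P (F \o f).
Proof.
move=> fi fQ /finsupp_cover[A AQ FA].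
apply: (@sub_finite_set _ _ (\bigcup_(j in [set` A]) (P `&` [set i | f i = j]))).
  move=> i [Pi /= Fi]; exists (f i) => //=.
  by apply: contraNT Fi => fA; rewrite /= FA//; exact: fQ.
apply: bigcup_finite => // j _.
have [[i [Pi fij]]|N] := pselect (exists i, P i /\ f i = j).
  apply: (sub_finite_set _ (finite_set1 i)) => i' [Pi' fi'j] /=.
  by apply: fi; [exact: mem_set|exact: mem_set|rewrite fij].
by apply: (sub_finite_set _ (finite_set0 _)) => i [Pi fij]; apply: N; exists i.
Qed.

Lemma finsupp_partition (T : finType) (P : set I) (Q : set J) (f : T -> I -> J)
    (F : J -> V) :
  (forall j, Q j -> exists t, exists2 i, P i & f t i = j) ->
  (forall t, finsupp_on P (F \o f t)) -> finsupp_on Q F.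
Proof.
move=> fs ft.
apply: (@sub_finite_set _ _ (\bigcup_(t in [set: T])
    (f t @` (P `&` [set i | F (f t i) != 0])))).
  by move=> j [/fs[t [i Pi <-]] /= Fj]; exists t => //; exists i.
apply: bigcup_finite => [|t _]; first exact: finite_finset.
exact/finite_image/ft.
Qed.

(** For instance the sum over a crystal group, decomposed along its point group, or
    the sum over a lattice, decomposed along the cosets of a sublattice. *)
Lemma fsbig_partition (T : finType) (P : set I) (Q : set J) (f : T -> I -> J)
    (F : J -> V) :
  (forall t i, P i -> Q (f t i)) ->
  (forall t t' i i', P i -> P i' -> f t i = f t' i' -> t = t' /\ i = i') ->
  (forall j, Q j -> exists t, exists2 i, P i & f t i = j) ->
  (forall t, finsupp_on P (F \o f t)) ->
  \sum_(j \in Q) F j = \sum_t \sum_(i \in P) F (f t i).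
Proof.
move=> fQ fi fs ft.
have [|A AP FA] := @finsupp_cover_seq V I P T (index_enum T) (fun t i => F (f t i)).
  by move=> t _; exact: ft.
transitivity (\sum_(p \in [set: T] `*` [set` A]) F (f p.1 p.2)).
  rewrite -(fsbig_widen ((fun p => f p.1 p.2) @` ([set: T] `*` [set` A]))).
  - apply: fsbig_image => -[t i] [t' i'] /set_mem[_ /= iA] /set_mem[_ /= iA'] e.
    by have [-> ->] := fi _ _ _ _ (AP _ iA) (AP _ iA') e.
  - by move=> j [[t i] [_ /= iA] <-]; apply: fQ; exact: AP.
  - move=> j [Qj nj] /=; have [t [i Pi tij]] := fs _ Qj.
    rewrite -tij; apply: (FA t i (mem_index_enum t) Pi).
    by apply/negP => iA; apply: nj; exists (t, i).
rewrite -(pair_fsbig _ (fun t i => F (f t i)))//; last exact: finite_finset.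
rewrite (fsbigE (index_enum T)) ?index_enum_uniq//; last first.
  by move=> t _; rewrite mem_index_enum.
apply: eq_big => t; first exact: mem_set.
move=> _; apply: fsbig_widen => // i [Pi /negP iA] /=.
exact: (FA t i (mem_index_enum t) Pi).
Qed.

End finite_support_reindex.

(** * Trigonometric polynomials *)

Section characters.
Context {R : realType} (d : nat).
Local Notation leb := (@lebesgue_cV R d).
Implicit Types (k l x y : 'cV[R]_d).

Lemma dotvDl k l x : dotv (k + l) x = dotv k x + dotv l x.
Proof. by rewrite /dotv -big_split; apply: eq_bigr => i _; rewrite mxE mulrDl. Qed.

Lemma dotvC k x : dotv k x = dotv x k.
Proof. by apply: eq_bigr => i _; rewrite mulrC. Qed.

Lemma dotvZl (z : R) k x : dotv (z *: k) x = z * dotv k x.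
Proof. by rewrite /dotv mulr_sumr; apply: eq_bigr => i _; rewrite mxE mulrA. Qed.

Lemma dotvNl k x : dotv (- k) x = - dotv k x.
Proof. by rewrite -scaleN1r dotvZl mulN1r. Qed.

Lemma dotv_mulmx (b : 'M[R]_d) k x : dotv (b *m k) x = dotv k (b^T *m x).
Proof. by rewrite !dotvE trmx_mul mulmxA. Qed.

Lemma dotv0l x : dotv 0 x = 0.
Proof. by rewrite -(scale0r 0) dotvZl mul0r. Qed.

Lemma expcharDl k l x : expchar (k + l) x = expchar k x * expchar l x.
Proof.
rewrite /expchar dotvDl mulrDr cosD sinD; apply/eqP; rewrite eq_complex /=.
by apply/andP; split; apply/eqP; ring.
Qed.

Lemma expcharC k x : expchar k x = expchar x k.
Proof. by rewrite /expchar dotvC. Qed.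

Lemma expcharDr k x y : expchar k (x + y) = expchar k x * expchar k y.
Proof. by rewrite expcharC expcharDl !(expcharC k). Qed.

Lemma expchar0 x : expchar 0 x = 1 :> R[i].
Proof. by rewrite /expchar dotv0l mulr0 cos0 sin0 oppr0. Qed.

Lemma expcharN k x : expchar (- k) x = conjc (expchar k x).
Proof. by rewrite /expchar dotvNl mulrN cosN sinN. Qed.

Lemma expchar_mulmx (b : 'M[R]_d) k x :
  expchar (b *m k) x = expchar k (b^T *m x).
Proof. by rewrite /expchar dotv_mulmx. Qed.

Lemma expcharNK k x : expchar k x * conjc (expchar k x) = 1.
Proof. by rewrite -expcharN -expcharDl subrr expchar0. Qed.

Lemma expchar_neq0 k x : expchar k x != 0.
Proof.
by apply/eqP => e; have := expcharNK k x; rewrite e mul0r => /eqP; rewrite eq_sym oner_eq0.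
Qed.

Lemma dotv_eq0 k : dotv k k = 0 -> k = 0.
Proof.
move=> /eqP; rewrite psumr_eq0 => [/allP k0|i _]; last by rewrite -expr2 sqr_ge0.
apply/matrixP => i j; rewrite ord1 mxE; apply/eqP.
by have := k0 i (mem_index_enum _); rewrite -expr2 sqrf_eq0.
Qed.

Lemma expchar_separates k l : k != l -> exists x, expchar k x != expchar l x.
Proof.
move=> kl; set t := k - l.
have t0 : dotv t t != 0.
  by apply: contra_neq kl => /dotv_eq0/eqP; rewrite subr_eq0 => /eqP.
(* at this point the two characters differ by the factor exp(- i pi) = -1 *)
exists ((2 * dotv t t)^-1 *: t); set x := _ *: t.
rewrite -[k](subrK l) expcharDl -[X in _ != X]mul1r.
rewrite (inj_eq (mulIf (expchar_neq0 _ _))).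
rewrite -/t /expchar (_ : 2 * pi * dotv t x = pi).
  by rewrite cospi sinpi oppr0 eq_complex /= eqxx andbT -subr_eq0; apply/eqP; lra.
by rewrite dotvC dotvZl; field.
Qed.

Lemma ae_nonempty (P : 'cV[R]_d -> Prop) : {ae leb, forall x, P x} -> exists x, P x.
Proof.
move=> aeP; apply: contrapT => /forallNP nP.
have [N [mN N0 NP]] := aeP.
have := lebesgue_cV_setT_gt0 d (R := R).
have -> : [set: 'cV[R]_d] = N by apply/seteqP; split=> // x _; apply: NP; exact: nP.
by rewrite [X in (_ < X)%E](N0 : _ = 0%E) ltxx.
Qed.

(** Dedekind's argument for the independence of characters: translating the relation
    and subtracting a multiple of it removes one frequency. Translations preserve
    null sets, so the argument applies to relations that hold almost everywhere. *)
Lemma trig_ae_eq0 (s : seq 'cV[R]_d) (c : 'cV[R]_d -> R[i]) : uniq s ->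
  {ae leb, forall x, \sum_(k <- s) expchar k x * c k = 0} ->
  {in s, forall k, c k = 0}.
Proof.
elim: s c => [|k0 s IH] c //= /andP[k0s us] c0.
have cs : {in s, forall k, c k = 0}.
  move=> k ks; have kk0 : k != k0 by apply: contraNneq k0s => <-.
  have [t kt] := expchar_separates kk0.
  have ct := ae_affine_cV t (unitmx1 R d) c0.
  have := IH (fun k => c k * (expchar k t - expchar k0 t)) us.
  move=> /(_ _ k ks) /eqP; rewrite mulf_eq0 subr_eq0 (negbTE kt) orbF => H.
  apply/eqP/H; apply: filterS2 c0 ct => x; rewrite !big_cons mul1mx => e e'.
  have : \sum_(k <- s) expchar k (x + t) * c k -
      expchar k0 t * (\sum_(k <- s) expchar k x * c k) = 0.
    move: e e' => /eqP; rewrite addrC addr_eq0 => /eqP -> /eqP.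
    by rewrite addrC addr_eq0 => /eqP ->; rewrite expcharDr; ring.
  rewrite mulr_sumr -sumrB => e2; rewrite -[RHS]e2.
  by apply: eq_bigr => j _; rewrite expcharDr; ring.
move=> k; rewrite in_cons => /orP[/eqP ->|]; last exact: cs.
have [x] := ae_nonempty c0.
rewrite big_cons big1_seq ?addr0 => [/eqP|j /andP[_ /cs ->]]; last by rewrite mulr0.
by rewrite mulf_eq0 (negbTE (expchar_neq0 _ _)) => /eqP.
Qed.

Lemma fsbig_trig_ae_eq0 (P : set 'cV[R]_d) (c : 'cV[R]_d -> R[i]) : finsupp_on P c ->
  {ae leb, forall x, \sum_(k \in P) expchar k x * c k = 0} ->
  forall k, P k -> c k = 0.
Proof.
move=> /finsupp_cover[A AP cA] c0 k Pk.
have [kA|/cA] := boolP (k \in A); last exact.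
apply: (@trig_ae_eq0 A c (fset_uniq A) _ k kA).
apply: filterS c0 => x e; rewrite -[RHS]e (fsbig_cover AP)// => j Pj jA.
by rewrite cA// mulr0.
Qed.

Lemma fsbig_trig_ae_cst (P : set 'cV[R]_d) (c : 'cV[R]_d -> R[i]) z : P 0 ->
  finsupp_on P c -> {ae leb, forall x, \sum_(k \in P) expchar k x * c k = z} ->
  forall k, P k -> c k = (k == 0)%:R * z.
Proof.
move=> P0 fc cz k Pk; apply/eqP; rewrite -subr_eq0; apply/eqP; move: k Pk.
have [A AP cA] := finsupp_cover fc.
pose c' k := c k - (k == 0)%:R * z.
have A'P : [set` (0 |` A)%fset] `<=` P.
  by move=> k /=; rewrite !inE => /orP[/eqP ->//|/AP].
have c'A k : P k -> k \notin (0 |` A)%fset -> c' k = 0.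
  rewrite !inE negb_or => Pk /andP[/negbTE k0 kA].
  by rewrite /c' k0 mul0r subr0 cA.
apply: (@fsbig_trig_ae_eq0 P c' (finsupp_onP c'A)).
apply: filterS cz => x.
rewrite (fsbig_cover A'P); last first.
  by move=> k Pk; rewrite !inE negb_or => /andP[_ kA]; rewrite cA// mulr0.
move=> cz.
rewrite (fsbig_cover A'P); last by move=> k Pk kA; rewrite c'A// mulr0.
under eq_bigr do rewrite mulrBr.
rewrite sumrB cz (big_fsetD1 0) ?fset1U1//= expchar0 eqxx !mul1r.
rewrite big1_fset ?addr0 ?subrr// => k; rewrite in_fsetD1 => /andP[/negbTE -> _] _.
by rewrite mul0r mulr0.
Qed.

Definition additive_subgroup (P : set 'cV[R]_d) :=
  P 0 /\ (forall k l, P k -> P l -> P (k - l)).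

(** The Fourier coefficients of the product of the trigonometric polynomial with
    coefficients [u] and the conjugate of the one with coefficients [w]. *)
Definition correlation (P : set 'cV[R]_d) (u w : 'cV[R]_d -> R[i]) v :=
  \sum_(k \in P) u k * conjc (w (k - v)).

Lemma correlation_list (P : set 'cV[R]_d) u w v (A : {fset 'cV[R]_d}) :
  [set` A] `<=` P -> (forall k, P k -> k \notin A -> u k = 0) ->
  correlation P u w v = \sum_(k <- A) u k * conjc (w (k - v)).
Proof.
by move=> AP uA; apply: fsbig_cover => // k Pk kA; rewrite uA// mul0r.
Qed.

Lemma finsupp_shift (P : set 'cV[R]_d) (w : 'cV[R]_d -> R[i]) k :
  additive_subgroup P -> P k -> finsupp_on P w ->
  finsupp_on P (fun v => conjc (w (k - v))).
Proof.
move=> [P0 PB] Pk fw.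
have : finsupp_on P (w \o (fun v => k - v)).
  apply: (finsupp_bij _ _ fw) => [v v' _ _ /addrI/oppr_inj //|v Pv]; exact: PB.
apply: sub_finite_set => v [Pv /=]; rewrite conjc_eq0 => wv; by split.
Qed.

Lemma finsupp_correlation (P : set 'cV[R]_d) (u w : 'cV[R]_d -> R[i]) :
  additive_subgroup P -> finsupp_on P u -> finsupp_on P w ->
  finsupp_on P (correlation P u w).
Proof.
move=> sP /finsupp_cover[A AP uA] fw.
rewrite (_ : correlation P u w = fun v => \sum_(k <- A) u k * conjc (w (k - v))).
  apply: finsupp_sum => k kA.
  apply: sub_finite_set (finsupp_shift sP (AP _ kA) fw) => v [Pv /=].
  by rewrite mulf_eq0 negb_or => /andP[].
by apply/funext => v; exact: correlation_list.
Qed.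

Lemma trig_mul_conj (P : set 'cV[R]_d) (u w : 'cV[R]_d -> R[i]) x :
  additive_subgroup P -> finsupp_on P u -> finsupp_on P w ->
  (\sum_(k \in P) expchar k x * u k) * conjc (\sum_(k \in P) expchar k x * w k) =
  \sum_(v \in P) expchar v x * correlation P u w v.
Proof.
move=> sP fu fw; have [A AP uA] := finsupp_cover fu.
have -> : \sum_(v \in P) expchar v x * correlation P u w v =
    \sum_(v \in P) \sum_(k <- A) expchar v x * (u k * conjc (w (k - v))).
  by apply: eq_fsbigr => v _; rewrite (correlation_list _ _ AP uA) mulr_sumr.
rewrite exchange_fsbig_seq; last first.
  move=> k kA; apply: sub_finite_set (finsupp_shift sP (AP _ kA) fw) => v [Pv /=].
  by rewrite !mulf_eq0 !negb_or => /andP[_ /andP[]].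
rewrite (@fsbig_cover _ _ P _ A)//; last by move=> k Pk kA; rewrite uA// mulr0.
rewrite mulr_suml; apply: eq_big_seq => k kA.
rewrite [RHS](reindex_fsbig (fun v => k - v) P); last first.
  have [_ PB] := sP.
  split=> [v Pv|v v' _ _ /addrI/oppr_inj //|v Pv]; first by apply: PB => //; exact: AP.
  by exists (k - v); [apply: PB => //; exact: AP|rewrite subKr].
have [B BP wB] := finsupp_cover fw.
rewrite (@fsbig_cover _ _ P (fun l => expchar l x * w l) B)//; last first.
  by move=> l Pl lB; rewrite wB// mulr0.
rewrite (@fsbig_cover _ _ P _ B)//; last first.
  by move=> l Pl lB; rewrite subKr wB// conjc0 !mulr0.
rewrite rmorph_sum mulr_sumr; apply: eq_bigr => l _.
by rewrite subKr rmorphM expcharDl expcharN /=; ring.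
Qed.

End characters.

(** * Unitary block matrices *)

Section block_matrices.
Context {R : realType} (r m : nat).
Implicit Types (A B : 'I_m -> 'I_m -> 'M[R[i]]_r.+1).

Lemma conjtr_mxblock A :
  (\mxblock_(i, j) A i j)^t* = \mxblock_(i, j) (A j i)^t*.
Proof.
rewrite tr_mxblock; apply/matrixP => i j; rewrite !mxE //.
Qed.

Lemma mxblock1 : 1%:M = \mxblock_(i < m, j < m) ((i == j)%:R%:M : 'M[R[i]]_r.+1).
Proof.
rewrite -mxdiagZ; apply: eq_mxblock => i j.
by case: (eqVneq i j) => [_|_]; rewrite ?conform_mx_id// raddf0.
Qed.

Lemma mxblock_unitaryP A :
  (\mxblock_(i, j) A i j \is unitarymx) <->
  forall i j, \sum_h A i h *m (A j h)^t* = (i == j)%:R%:M.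
Proof.
split=> [/unitarymxP|h]; last apply/unitarymxP.
  by rewrite conjtr_mxblock mul_mxblock mxblock1 => /eq_mxblockP.
by rewrite conjtr_mxblock mul_mxblock mxblock1; apply/eq_mxblockP.
Qed.

(** For a square matrix, orthonormal rows entail orthonormal columns. *)
Lemma mxblock_unitary_adjoint A : \mxblock_(i, j) A i j \is unitarymx ->
  forall i j, \sum_h (A h i)^t* *m A h j = (i == j)%:R%:M.
Proof.
move=> /unitarymxP /mulmx1C; rewrite conjtr_mxblock mul_mxblock mxblock1.
by move/eq_mxblockP.
Qed.

End block_matrices.

(** * Dual lattices *)

Section dual_lattices.
Context {R : realType} (d : nat).
Implicit Types (k l x y : 'cV[R]_d).

Lemma cos_sin_2pi_int (z : int) :
  cos (2 * pi * z%:~R : R) = 1 /\ sin (2 * pi * z%:~R : R) = 0.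
Proof.
have H (n : nat) : cos (2 * pi * n%:R : R) = 1 /\ sin (2 * pi * n%:R : R) = 0.
  elim: n => [|n [c s]]; first by rewrite mulr0 cos0 sin0.
  rewrite [n.+1%:R]mulrSr (mulrDr (2 * pi)) mulr1 cosD sinD c s.
  by rewrite mulr_natl cos2pi sin2pi !mul1r !mul0r subr0 addr0.
case: z => n; first exact: H.
rewrite NegzE mulrNz mulrN cosN sinN -pmulrn.
by have [-> ->] := H n.+1; rewrite oppr0.
Qed.

Lemma expchar_int k x : dotv k x \is a Num.int -> expchar k x = 1.
Proof.
by move=> /intrP[z kx]; rewrite /expchar kx; have [-> ->] := cos_sin_2pi_int z;
  rewrite oppr0.
Qed.

(** On the half period where it is injective, the cosine equals 1 only at 0; the
    other half is reflected onto it. *)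
Lemma expchar_eq1_int k x : expchar k x = 1 -> dotv k x \is a Num.int.
Proof.
rewrite /expchar; set y := dotv k x => -[c1 _].
pose f := y - (Num.floor y)%:~R.
have f0 : 0 <= f by rewrite subr_ge0 floor_le.
have f1 : f < 1 by have := floorD1_gt y; rewrite /f ltrBlDl intrD.
have cf : cos (2 * pi * f) = 1.
  rewrite /f mulrBr cosB; have [c s] := cos_sin_2pi_int (Num.floor y).
  by rewrite c s c1 mulr1 mulr0 addr0.
have p0 := pi_gt0 R.
suff f00 : f = 0 by rewrite (_ : y = (Num.floor y)%:~R) ?intr_int//; apply/eqP;
  rewrite -subr_eq0; apply/eqP.
have [fh|fh] := leP f (1 / 2).
  have : 2 * pi * f = 0.
    by apply: cos_inj; rewrite ?in_itv/= ?cos0//; apply/andP; split; nra.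
  by move=> /eqP; rewrite !mulf_eq0 pnatr_eq0 (gt_eqF p0) => /eqP.
have : 2 * pi * (1 - f) = 0.
  apply: cos_inj; rewrite ?in_itv/= ?cos0; try by apply/andP; split; nra.
  by rewrite mulrBr mulr1 cosB mulr_natl cos2pi sin2pi -mulr_natl cf mul1r mul0r addr0.
by move=> /eqP; rewrite !mulf_eq0 pnatr_eq0 (gt_eqF p0) subr_eq0 => /eqP f1'; lra.
Qed.

Lemma full_rank_lattice_subgroup (L : set 'cV[R]_d) :
  full_rank_lattice L -> additive_subgroup L.
Proof.
move=> [B uB ->]; split; first by exists 0 => //; rewrite map_mx0 mulmx0.
move=> _ _ [z _ <-] [z' _ <-]; exists (z - z') => //.
by rewrite map_mxB mulmxBr.
Qed.

(** The coordinates of [x] in a basis of the lattice are its products with the dual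
    basis, and these are integers. *)
Lemma dual_dual_lattice (L : set 'cV[R]_d) x : full_rank_lattice L ->
  (forall xi, dual_lattice L xi -> expchar x xi = 1) -> L x.
Proof.
move=> [B uB ->] h.
have int_coord i : (invmx B *m x) i ord0 \is a Num.int.
  have dualB : dual_lattice (range (fun z : 'cV[int]_d => B *m map_mx intr z))
      (invmx B^T *m delta_mx i ord0).
    move=> _ [z _ <-].
    rewrite dotv_mulmx mulmxA mulmxV ?unitmx_tr// mul1mx /dotv (bigD1 i)//=.
    rewrite big1 => [|j ji]; last by rewrite !mxE (negbTE ji) mulr0.
    by rewrite !mxE !eqxx mulr1 addr0 intr_int.
  have := expchar_eq1_int (h _ dualB).
  rewrite -trmx_inv -dotv_mulmx /dotv (bigD1 i)//=.
  rewrite big1 => [|j ji]; last by rewrite [X in _ * X]mxE (negbTE ji) mulr0.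
  by rewrite [X in _ * X]mxE !eqxx mulr1 addr0.
exists (\col_i Num.floor ((invmx B *m x) i ord0)) => //.
rewrite -[RHS](mulKVmx uB); congr (_ *m _).
apply/matrixP => i j; rewrite !ord1 [LHS]mxE [X in X%:~R]mxE.
by have := int_coord i; rewrite intrEfloor => /eqP.
Qed.

Lemma dual_latticeP (L : set 'cV[R]_d) : additive_subgroup (dual_lattice L).
Proof.
split=> [k _|x y Lx Ly k Lk]; first by rewrite dotvC dotv0l rpred0.
by rewrite dotvC dotvDl dotvNl rpredB//; rewrite dotvC; [exact: Lx|exact: Ly].
Qed.

Lemma coset_reps_inj m (L : set 'cV[R]_d) (b : 'M[R]_d) (c : 'I_m -> 'cV[R]_d) :
  additive_subgroup L -> coset_reps L b c ->
  forall i j, (mulmx b @` L) (c i - c j) -> i = j.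
Proof.
move=> [L0 LB] [cL ex] i j cij.
have [s [_ us]] := ex _ (cL i).
rewrite -(us j cij); apply/esym/us; exists 0 => //.
by rewrite mulmx0 subrr.
Qed.

(** Orthogonality of characters on the finite group of cosets of [a^T] times the dual
    lattice. As [y] is not in the lattice, some dual vector [xi] has
    [expchar y xi != 1]; translating the representatives by [xi] permutes the cosets
    and multiplies the sum by this number. *)
Lemma sum_expchar_dual m (L : set 'cV[R]_d) (a : 'M[R]_d) (rho : 'I_m -> 'cV[R]_d) y :
  full_rank_lattice L -> coset_reps (dual_lattice L) a^T rho ->
  L (a *m y) -> ~ L y -> \sum_j expchar y (rho j) = 0.
Proof.
move=> Ll hrho Lay nLy; have [rL ex] := hrho.
have [D0 DB] := dual_latticeP L.
have [xi [Dxi exi]] : exists xi, dual_lattice L xi /\ expchar y xi != 1.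
  apply: contrapT => /forallNP H; apply: nLy; apply: dual_dual_lattice => // xi Dxi.
  by apply/eqP; apply: contra_notT (H xi) => e; split.
have DN z : dual_lattice L z -> dual_lattice L (- z).
  by move=> Dz; rewrite -sub0r; exact: DB.
have ts j : exists s, (mulmx a^T @` dual_lattice L) (rho j + xi - rho s).
  have [|s [hs _]] := ex (rho j + xi); last by exists s.
  by rewrite -[xi]opprK; apply: DB => //; exact: DN.
have /choice[sg hsg] := ts.
have sg_inj : injective sg.
  move=> i j eij; apply: (coset_reps_inj (dual_latticeP L) hrho).
  have [u Du ui] := hsg i; have [v Dv vj] := hsg j.
  exists (u - v); first exact: DB.
  by rewrite mulmxBr ui vj eij; apply/matrixP => p q; rewrite !mxE; ring.
have e1 j : expchar y (rho j) * expchar y xi = expchar y (rho (sg j)).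
  have [u Du uj] := hsg j.
  rewrite -expcharDr; have -> : rho j + xi = rho (sg j) + a^T *m u.
    by rewrite uj [RHS]addrC subrK.
  rewrite expcharDr -expchar_mulmx [X in _ * X]expchar_int ?mulr1//.
  by apply: Du.
have : (\sum_j expchar y (rho j)) * (expchar y xi - 1) = 0.
  rewrite mulrBr mulr1 mulr_suml [X in _ - X](reindex_inj sg_inj)/=.
  by rewrite -sumrB big1// => j _; rewrite e1 subrr.
by move=> /eqP; rewrite mulf_eq0 subr_eq0 (negbTE exi) orbF => /eqP.
Qed.

End dual_lattices.

(** * Splitting crystal groups *)

Section crystal.
Context {R : realType} (d r : nat) (Gam : set (aff R d)) (g : 'I_r.+1 -> 'M[R]_d)
  (Lam : set 'cV[R]_d) (htriple : splitting_crystal_triple Gam g Lam)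
  (a : 'M[R]_d) (hadm : admissible Gam a).
Implicit Types (u v : aff R d) (k : 'cV[R]_d).

Lemma admissible_unit : a \in unitmx.
Proof.
have [ev _] := hadm; apply: contraT => au.
have e0 : eigenvalue (map_mx (real_complex R) a) 0.
  rewrite /eigenvalue /eigenspace raddf0 subr0 kermx_eq0 row_free_unit.
  by rewrite map_unitmx.
by have := ev _ e0; rewrite normr0 ltr10.
Qed.

Lemma crystal_comp u v : Gam u -> Gam v -> Gam (aff_comp u v).
Proof. by have [[_ + _] _ _ _] := sct_crystal htriple; apply. Qed.

Lemma crystal_inv u : Gam u -> Gam (aff_inv u).
Proof. by have [[_ _ +] _ _ _] := sct_crystal htriple; apply. Qed.

Lemma crystal_unit u : Gam u -> u.1 \in unitmx.
Proof. by have [_ + _ _] := sct_crystal htriple => /[apply]; exact: isometry_unit. Qed.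

Lemma crystal_det u : Gam u -> `|\det u.1| = 1.
Proof. by have [_ + _ _] := sct_crystal htriple => /[apply]; exact: isometry_det. Qed.

Lemma translationP k : Lam k <-> Gam (translation k).
Proof. by rewrite (sct_trans htriple). Qed.

Lemma lattice_subgroup : additive_subgroup Lam.
Proof. exact: full_rank_lattice_subgroup (sct_lattice htriple). Qed.

Lemma lattice_opp k : Lam k -> Lam (- k).
Proof.
by move=> Lk; rewrite -sub0r; apply: lattice_subgroup.2 => //; exact: lattice_subgroup.1.
Qed.

Lemma lattice_add k l : Lam k -> Lam l -> Lam (k + l).
Proof.
by move=> Lk Ll; rewrite -[l]opprK; apply: lattice_subgroup.2 => //; exact: lattice_opp.
Qed.

Lemma crystal_point i : Gam (linear_aff (g i)).
Proof.
rewrite (sct_split htriple) /=; exists i, 0; first exact: lattice_subgroup.1.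
by rewrite /crystal mulmx0.
Qed.

Lemma point_unit i : g i \in unitmx.
Proof. exact: (crystal_unit (crystal_point i)). Qed.

(** Conjugating a translation by an element of the group gives a translation. *)
Lemma lattice_linear_part u k : Gam u -> Lam k -> Lam (u.1 *m k).
Proof.
move=> Gu /translationP Gk; apply/translationP.
have uu := crystal_unit Gu.
have -> : translation (u.1 *m k) = aff_comp (aff_comp u (translation k)) (aff_inv u).
  case: u Gu uu => A t Gu /= uu; rewrite /translation /aff_comp /= mulmx1 mulmxV//.
  by rewrite mulmxN mulmxA mulmxV// mul1mx addrCA addNr addr0.
by apply: crystal_comp; [exact: crystal_comp|exact: crystal_inv].
Qed.

Lemma crystal_pair i k : Lam k -> Gam (g i, k).
Proof.
move=> /translationP Gk; have := crystal_comp Gk (crystal_point i).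
by rewrite /aff_comp /= mul1mx mulmx0 add0r.
Qed.

Lemma crystal_pairP u : Gam u -> exists i, exists2 k, Lam k & (g i, k) = u.
Proof.
move=> Gu; have [i [k Lk uE]] : exists i, exists2 k, Lam k & u = crystal (g i) k.
  by rewrite (sct_split htriple) in Gu.
exists i, (g i *m k) => //.
exact: (lattice_linear_part (crystal_point i) Lk).
Qed.

Definition conja u := aff_comp (aff_comp (linear_aff a) u) (aff_inv (linear_aff a)).

Lemma crystal_conja u : Gam u -> Gam (conja u).
Proof. exact: hadm.2. Qed.

Lemma conjaE A k : conja (A, k) = (a *m A *m invmx a, a *m k).
Proof. by rewrite /conja /aff_comp /aff_inv /= mulmx0 oppr0 mulmx0 add0r addr0. Qed.

Lemma lattice_mulmx k : Lam k -> Lam (a *m k).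
Proof.
move=> /translationP Gk; apply/translationP.
have := crystal_conja Gk; rewrite conjaE mulmx1 mulmxV//; exact: admissible_unit.
Qed.

Lemma fsbig_crystal (V : zmodType) (F : aff R d -> V) : finsupp_on Gam F ->
  \sum_(u \in Gam) F u = \sum_j \sum_(k \in Lam) F (g j, k).
Proof.
move=> fF; apply: (@fsbig_partition _ _ _ _ Lam Gam (fun j k => (g j, k) : aff R d)).
- by move=> j k; exact: crystal_pair.
- by move=> j j' k k' _ _ [/(sct_inj htriple) -> ->].
- by move=> u /crystal_pairP.
- move=> j; apply: finsupp_bij fF; last by move=> k; exact: crystal_pair.
  by move=> k k' _ _ [].
Qed.

(** The row and the shift of a coefficient matrix are absorbed by one group element:
    all entries are values of left translates of the same function on the group. *)
Lemma ctildeE (c : aff R d -> R[i]) k k' i j :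
  ctilde g a c (k - a *m k') i j =
  c (aff_comp (aff_inv (conja (g i, k'))) (g j, k)).
Proof.
rewrite mxE conjaE /crystal /aff_comp /aff_inv /=; congr (c (_, _)).
by rewrite -[_ *m (invmx (g j) *m _)]mulmxA mulKVmx ?point_unit// mulmxBr.
Qed.

(** The symmetry of the coefficient matrices of a refinement equation holds by
    construction: the matrices are read off a single function on the group. *)
Lemma ctilde_symmetry (c : aff R d -> R[i]) : crystal_symmetry g Lam a (ctilde g a c).
Proof.
move=> k i j h p Lk gh gp; rewrite !mxE; congr c.
have au := admissible_unit.
rewrite (sct_id htriple) mulmx1 mulmxV// invmx1 mul1mx -gh -gp.
rewrite /crystal; congr (_, _ *m _).
rewrite -[LHS](mulKmx (point_unit p)); congr (_ *m _).
by rewrite gp -mulmxA mulKVmx// point_unit.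
Qed.

Lemma finsupp_ctilde (c : aff R d -> R[i]) i j :
  finite_set (Gam `&` [set u | c u != 0]) ->
  finsupp_on Lam (fun k => ctilde g a c k i j).
Proof.
move=> fc.
have Gh := crystal_inv (crystal_conja (crystal_point i)).
have : finsupp_on Lam (c \o (fun k => aff_comp (aff_inv (conja (linear_aff (g i)))) (g j, k))).
  apply: (@finsupp_bij _ _ _ Lam Gam) => [k k' _ _|k Lk|//].
    move=> /(congr1 (aff_comp (conja (linear_aff (g i))))).
    rewrite !aff_compVKl; try exact/crystal_unit/crystal_conja/crystal_point.
    by case.
  by apply: crystal_comp => //; exact: crystal_pair.
apply: sub_finite_set => k [Lk /=]; split=> //=.
by have := ctildeE c k 0 i j; rewrite mulmx0 subr0 => <-.
Qed.

End crystal.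

(** * The scaled space and refinement equations *)

Section dilated_basis.
Context {R : realType} (d r m : nat) (Gam : set (aff R d)) (g : 'I_r.+1 -> 'M[R]_d)
  (Lam : set 'cV[R]_d) (htriple : splitting_crystal_triple Gam g Lam)
  (a : 'M[R]_d) (hadm : admissible Gam a) (hm : m%:R = `|\det a|)
  (V : int -> set ('cV[R]_d -> R[i])) (phi : 'cV[R]_d -> R[i])
  (hMRA : is_MRA Gam a V (fun _ : 'I_1 => phi)).
Local Notation leb := (@lebesgue_cV R d).
Local Notation fn := ('cV[R]_d -> R[i]).
Implicit Types (u v : aff R d) (k : 'cV[R]_d).

Let a_unit := admissible_unit hadm.
Let ainv := aff_inv (linear_aff a).
Let ainv_unit : ainv.1 \in unitmx := aff_inv_unit (u := linear_aff a) a_unit.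
Let Gunit := crystal_unit htriple.

Lemma index_gt0 : (0 < m)%N.
Proof.
by rewrite -(ltr0n R) hm normr_gt0 -unitfE -unitmxE.
Qed.

Let sm_gt0 : 0 < Num.sqrt (m%:R : R).
Proof. by rewrite sqrtr_gt0 ltr0n index_gt0. Qed.

Lemma L2_dilate_phi u : Gam u -> L2 (dilate u phi).
Proof. by have [+ _ _] := mra_scaling hMRA => /(_ (u, ord0)). Qed.

Lemma ip_dilate_phi u v : Gam u -> Gam v ->
  ip (dilate u phi) (dilate v phi) = (u == v)%:R.
Proof.
move=> Gu Gv; have [_ + _] := mra_scaling hMRA => /(_ (u, ord0) (v, ord0) Gu Gv) ->.
by rewrite xpair_eqE eqxx andbT.
Qed.

(** The orthonormal basis [D_a^-1 D_u phi] of [V 1], written as a single dilation. *)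
Definition dbasis u : fn := dilate (aff_comp ainv u) phi.

Lemma dbasisE u : Gam u -> dbasis u = dilate ainv (dilate u phi).
Proof. by move=> Gu; rewrite dilate_comp// Gunit. Qed.

Lemma dilate_dbasis u : Gam u -> dilate (linear_aff a) (dbasis u) = dilate u phi.
Proof.
move=> Gu; rewrite dbasisE// dilate_comp// aff_compVr//.
exact: dilate1.
Qed.

Lemma L2_dbasis u : Gam u -> L2 (dbasis u).
Proof. by move=> Gu; rewrite dbasisE//; apply/L2_dilate/L2_dilate_phi. Qed.

Lemma ip_dbasis u v : Gam u -> Gam v -> ip (dbasis u) (dbasis v) = (u == v)%:R.
Proof.
by move=> Gu Gv; rewrite !dbasisE// ip_dilate ?ip_dilate_phi//; exact: L2_dilate_phi.
Qed.

Lemma dbasis_app u x : Gam u ->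
  dbasis u x = (Num.sqrt m%:R)%:C * phi (aff_app (aff_inv u) (a *m x)).
Proof.
move=> Gu; rewrite /dbasis /dilate aff_inv_comp ?(Gunit Gu)// aff_invK//.
rewrite aff_app_comp [aff_app (linear_aff a) x]addr0; congr (_%:C * _).
rewrite /= det_mulmx normrM (crystal_det htriple Gu) mulr1 det_inv normfV -hm.
by rewrite sqrtrV ?invrK.
Qed.

Lemma scaled_spaceE : V 1 = dilate (linear_aff a) @^-1` (V 0).
Proof. by have := mra_dilate hMRA 0; rewrite add0r. Qed.

Lemma span_V0 : L2closure (lin_span
   [set p : 'M[R]_d * 'cV[R]_d * 'I_1 | Gam p.1] (fun p => dilate p.1 phi)) = V 0.
Proof. by have [] := mra_scaling hMRA. Qed.

Lemma V0_dilate_phi u : Gam u -> V 0 (dilate u phi).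
Proof.
move=> Gu; rewrite -span_V0; apply: sub_L2closure.
  have [+ _ _] := @lin_span_subspace R d _ [set p : 'M[R]_d * 'cV[R]_d * 'I_1 | Gam p.1]
    (fun p => dilate p.1 phi) (fun p => @L2_dilate_phi p.1).
  exact.
exact: (@mem_lin_span R d _ [set p : 'M[R]_d * 'cV[R]_d * 'I_1 | Gam p.1]
    (fun p => dilate p.1 phi) (u, ord0)).
Qed.

Lemma V1_dbasis u : Gam u -> V 1 (dbasis u).
Proof. by move=> Gu; rewrite scaled_spaceE /= dilate_dbasis//; exact: V0_dilate_phi. Qed.

(** [D_a] is an isometry from [V 1] onto [V 0] and takes the dilated basis to the
    given one, so approximants in [V 0] can be pulled back. *)
Lemma V1_sub_span (W : set fn) : closed_subspace W ->
  (forall u, Gam u -> W (dbasis u)) -> V 1 `<=` W.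
Proof.
move=> cW Wd f V1f; have [WL _ _ Wc] := cW.
have f2 : L2 f by have [+ _ _ _] := mra_closed hMRA 1; apply.
apply: Wc; split=> // e e0.
move: V1f; rewrite scaled_spaceE /= -span_V0 => -[_ /(_ e e0) [_ [A [b [AD ->]]]]].
move=> fA; exists (fun x => \sum_(p <- A) b p * dbasis p.1 x).
  by apply: closed_subspace_sum => // p pA; apply: Wd; exact: (AD _ pA).
rewrite -(@L2norm_dilate _ _ (linear_aff a))//; last first.
  apply: L2_sub => //; apply: L2_sum => p pA; apply: L2_dbasis; exact: (AD _ pA).
have -> : dilate (linear_aff a) (fun x => f x - \sum_(p <- A) b p * dbasis p.1 x) =
    (fun x => dilate (linear_aff a) f x - \sum_(p <- A) b p * dilate p.1 phi x).
  have -> : (fun x => f x - \sum_(p <- A) b p * dbasis p.1 x) =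
    (fun x => (-1) * (\sum_(p <- A) b p * dbasis p.1 x) + f x).
    by apply/funext => x; rewrite mulN1r addrC.
  rewrite dilate_lin dilate_sum; apply/funext => x; rewrite mulN1r addrC.
  congr (_ - _); apply: eq_big_seq => p pA; rewrite dilate_dbasis//; exact: (AD _ pA).
exact: fA.
Qed.

Lemma V0_orthogonal f h : L2 f -> (forall u, Gam u -> ip (dilate u phi) f = 0) ->
  V 0 h -> ip h f = 0.
Proof.
move=> f2 fo; rewrite -span_V0; apply: ip_L2closure_eq0 => //.
  move=> _ [A [b [AD ->]]]; apply: L2_sum => p pA; apply: L2_dilate_phi; exact: (AD _ pA).
move=> _ [A [b [AD ->]]]; rewrite ip_suml//; last first.
  by move=> p pA; apply: L2_dilate_phi; exact: (AD _ pA).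
by rewrite big1_seq// => p /andP[_ pA]; rewrite fo ?mulr0//; exact: (AD _ pA).
Qed.

Section refinement_expansion.
Context (psi : fn) (V1psi : V 1 psi) (c : aff R d -> R[i]) (hc : refinable a Gam phi c psi).

(** The coefficient of [D_u psi] on the basis vector indexed by [v], up to the factor
    [m^(-1/2)]. *)
Definition dcoef u v : R[i] := c (aff_comp (aff_inv (conja a u)) v).

Let L2psi : L2 psi.
Proof. by have [+ _ _ _] := mra_closed hMRA 1; apply. Qed.

Lemma finsupp_dcoef u : Gam u -> finsupp_on Gam (dcoef u).
Proof.
move=> Gu; have Gc := crystal_conja hadm Gu.
apply: (@finsupp_bij _ _ _ Gam Gam (aff_comp (aff_inv (conja a u)))).
- move=> v v' _ _ /(congr1 (aff_comp (conja a u))).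
  by rewrite !aff_compVKl ?Gunit.
- by move=> v Gv; apply: (crystal_comp htriple) => //; exact: (crystal_inv htriple).
- exact: hc.1.
Qed.

(** Conjugating by [a] moves a dilation past [D_a^-1]; it acts on the coefficients of
    the refinement equation by a translation of the group. *)
Lemma dilate_refinable u : Gam u ->
  exists A : {fset aff R d}, [/\ [set` A] `<=` Gam,
    forall v, Gam v -> v \notin A -> dcoef u v = 0 &
    {ae leb, forall x, dilate u psi x =
      \sum_(v <- A) (dcoef u v / (Num.sqrt m%:R)%:C) * dbasis v x}].
Proof.
move=> Gu; have Gc := crystal_conja hadm Gu.
have [A AG cA] := finsupp_cover (finsupp_dcoef Gu).
exists A; split=> //.
have uu := Gunit Gu.
have := ae_affine_cV (aff_inv u).2 (aff_inv_unit uu) hc.2.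
apply: filterS => x e.
rewrite /dilate (crystal_det htriple Gu) sqrtr1 invr1 mul1r.
rewrite /aff_app e.
rewrite (reindex_fsbig (aff_comp (aff_inv (conja a u))) Gam); last first.
  split.
  - by move=> v Gv; apply: (crystal_comp htriple) => //; exact: (crystal_inv htriple).
  - move=> v v' _ _ /(congr1 (aff_comp (conja a u))).
    by rewrite !aff_compVKl ?Gunit.
  - move=> v Gv; exists (aff_comp (conja a u) v); first exact: (crystal_comp htriple).
    by rewrite aff_compKl// Gunit.
rewrite (fsbig_cover AG); last by move=> v Gv vA; rewrite -/(dcoef u v) cA// mul0r.
apply: eq_big_seq => v vA; have Gv := AG _ vA.
rewrite dbasis_app// -/(dcoef u v) mulrA divfK; last first.
  by rewrite fmorph_eq0 gt_eqF.
congr (_ * phi _).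
have vu := Gunit Gv; have cu := Gunit Gc.
rewrite aff_inv_comp ?aff_inv_unit// aff_invK// aff_app_comp; congr aff_app.
rewrite -/(aff_app (aff_inv u) x).
have E y : a *m y = aff_app (linear_aff a) y by rewrite /aff_app addr0.
rewrite !E -!aff_app_comp; congr (aff_app _ x).
by rewrite /conja -!aff_compA aff_compKl// aff_compVr// aff_comp1r.
Qed.

Lemma L2_dilate_psi u : Gam u -> L2 (dilate u psi).
Proof. by move=> Gu; exact: (L2_dilate (Gunit Gu) L2psi). Qed.

Lemma V1_dilate_psi u : Gam u -> V 1 (dilate u psi).
Proof.
move=> Gu; have [A [AG _ e]] := dilate_refinable Gu.
apply: (closed_subspace_ae (mra_closed hMRA 1) _ (L2_dilate_psi Gu)); last first.
  by apply: filterS e => x ->.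
apply: closed_subspace_sum; first exact: (mra_closed hMRA 1).
by move=> v /AG; exact: V1_dbasis.
Qed.

Lemma ip_dilate_psi_sum u h : Gam u -> L2 h ->
  exists A : {fset aff R d}, [/\ [set` A] `<=` Gam,
    forall v, Gam v -> v \notin A -> dcoef u v = 0 &
    ip (dilate u psi) h =
      \sum_(v <- A) (dcoef u v / (Num.sqrt m%:R)%:C) * ip (dbasis v) h].
Proof.
move=> Gu h2; have [A [AG cA e]] := dilate_refinable Gu; exists A; split=> //.
have hA : {in A, forall v, L2 (dbasis v)} by move=> v /AG; exact: L2_dbasis.
rewrite -ip_suml//; apply: ip_ae => //; [exact: L2_dilate_psi|exact: L2_sum|].
exact: aeW.
Qed.

Lemma ip_dilate_psi_dbasis u v : Gam u -> Gam v ->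
  ip (dilate u psi) (dbasis v) = dcoef u v / (Num.sqrt m%:R)%:C.
Proof.
move=> Gu Gv; have [A [AG cA ->]] := ip_dilate_psi_sum Gu (L2_dbasis Gv).
have [vA|vA] := boolP (v \in A).
  rewrite (big_fsetD1 v)//= ip_dbasis// eqxx mulr1 big1_fset ?addr0// => w.
  rewrite in_fsetD1 => /andP[/negbTE wv wA] _.
  by rewrite ip_dbasis ?wv ?mulr0//; exact: AG.
rewrite (cA _ Gv vA) mul0r big1_seq// => w /andP[_ wA].
rewrite ip_dbasis//; last exact: AG.
by case: eqP => [wv|]; rewrite ?mulr0//; rewrite -wv wA in vA.
Qed.

End refinement_expansion.

Lemma ip_dilate_psi (psi psi' : fn) (c c' : aff R d -> R[i]) u u' :
  V 1 psi -> V 1 psi' -> refinable a Gam phi c psi -> refinable a Gam phi c' psi' ->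
  Gam u -> Gam u' ->
  ip (dilate u psi) (dilate u' psi') =
  m%:R^-1 * \sum_(v \in Gam) dcoef c u v * conjc (dcoef c' u' v).
Proof.
move=> V1psi V1psi' hc hc' Gu Gu'.
rewrite ip_conj; [|exact: L2_dilate_psi|exact: L2_dilate_psi].
have [A [AG cA ->]] :=
  ip_dilate_psi_sum V1psi' hc' Gu' (L2_dilate_psi V1psi Gu).
rewrite (fsbig_cover AG); last first.
  by move=> v Gv vA; rewrite cA// conjc0 mulr0.
rewrite mulr_sumr rmorph_sum; apply: eq_big_seq => v /AG Gv.
have s2 : ((Num.sqrt m%:R)%:C : R[i])^-1 * (Num.sqrt m%:R)%:C^-1 = m%:R^-1.
  by rewrite -invfM -rmorphM -expr2 sqr_sqrtr// rmorph_nat.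
have sc : conjc ((Num.sqrt m%:R)%:C : R[i])^-1 = (Num.sqrt m%:R)%:C^-1.
  by rewrite conjc_inv conjc_real.
have cM (z w : R[i]) : conjc (z / (Num.sqrt m%:R)%:C * w) =
    conjc z / (Num.sqrt m%:R)%:C * conjc w.
  by rewrite !rmorphM; congr (_ * _ * _); exact: sc.
rewrite /= cM -(ip_conj (L2_dilate_psi V1psi Gu) (L2_dbasis Gv)).
rewrite (ip_dilate_psi_dbasis V1psi hc Gu Gv).
by rewrite -s2; ring.
Qed.



End dilated_basis.

(** * Gram matrices and polyphase matrices *)

Lemma fsbig_mxE (V : zmodType) (I : choiceType) (P : set I) n1 n2
    (F : I -> 'M[V]_(n1, n2)) p q :
  (forall p q, finsupp_on P (fun i => F i p q)) ->
  (\sum_(i \in P) F i) p q = \sum_(i \in P) F i p q.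
Proof.
move=> fF.
have [|A AP FA] := @finsupp_cover_seq V I P _ (index_enum ('I_n1 * 'I_n2)%type)
  (fun t i => F i t.1 t.2); first by move=> t _; exact: fF.
have FA' i p' q' : P i -> i \notin A -> F i p' q' = 0.
  by move=> Pi; apply: (FA (p', q')) => //; exact: mem_index_enum.
rewrite [in LHS](@fsbig_cover _ _ P F A AP); last first.
  by move=> i Pi iA; apply/matrixP => p' q'; rewrite FA'// mxE.
rewrite (fsbig_cover AP); last by move=> i Pi iA; rewrite FA'.
by rewrite summxE.
Qed.

Section gram.
Context {R : realType} (d r m : nat) (Gam : set (aff R d)) (g : 'I_r.+1 -> 'M[R]_d)
  (Lam : set 'cV[R]_d) (htriple : splitting_crystal_triple Gam g Lam)
  (a : 'M[R]_d) (hadm : admissible Gam a) (hm : m%:R = `|\det a|)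
  (dig : 'I_m -> 'cV[R]_d) (hdig : coset_reps Lam a dig)
  (V : int -> set ('cV[R]_d -> R[i])) (phi : 'cV[R]_d -> R[i])
  (hMRA : is_MRA Gam a V (fun _ : 'I_1 => phi))
  (psi : 'I_m -> 'cV[R]_d -> R[i]) (hpsi : forall l : 'I_m, V 1 (psi l))
  (c : 'I_m -> aff R d -> R[i])
  (hc : forall l : 'I_m, refinable a Gam phi (c l) (psi l)).
Implicit Types (u : aff R d) (k v : 'cV[R]_d) (l h : 'I_m) (p q j : 'I_r.+1).

Let a_unit := admissible_unit hadm.
Let sLam := lattice_subgroup htriple.
Let Lmul k : Lam k -> Lam (a *m k) := lattice_mulmx htriple hadm (k := k).

Local Notation ct l k := (ctilde g a (c l) k).

Let fct l p j : finsupp_on Lam (fun k => ct l k p j).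
Proof. exact: (finsupp_ctilde htriple hadm _ _ (hc l).1). Qed.

(** The entry at [(p, q)] of the left-hand side of condition (d) for the shift [k]. *)
Definition shift_gram l l' p q k : R[i] :=
  m%:R^-1 * \sum_j \sum_(i \in Lam) ct l i p j * conjc (ct l' (i - a *m k) q j).

(** Both vectors are expanded in the orthonormal basis of [V 1]; the sum over the
    group splits into a sum over the point group and one over the lattice, and the
    latter is translated so that only the difference of the two shifts remains. *)
Lemma ip_dilate_pair l l' p q k k' : Lam k -> Lam k' ->
  ip (dilate (g p, k) (psi l)) (dilate (g q, k') (psi l')) =
  shift_gram l l' p q (k' - k).
Proof.
move=> Lk Lk'.
have Gp := crystal_pair htriple p Lk; have Gq := crystal_pair htriple q Lk'.
rewrite (ip_dilate_psi htriple hadm hm hMRA (hpsi l) (hpsi l') (hc l) (hc l') Gp Gq).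
congr (_ * _); rewrite (fsbig_crystal htriple); last first.
  apply: sub_finite_set (finsupp_dcoef htriple hadm (hc l) Gp) => v [Gv /=].
  by rewrite mulf_eq0 negb_or => /andP[].
apply: eq_bigr => j _.
rewrite (reindex_fsbig (fun i => i + a *m k) Lam); last first.
  split=> [i Li|i i' _ _ /addIr//|i Li].
    by apply: (lattice_add htriple) => //; exact: Lmul.
  by exists (i - a *m k); [apply: sLam.2 => //; exact: Lmul|rewrite subrK].
apply: eq_fsbigr => i _; congr (_ * conjc _).
  by rewrite /dcoef -(ctildeE htriple) addrK.
by rewrite /dcoef -(ctildeE htriple) mulmxBr opprB addrA.
Qed.

(** The matrix identity of condition (d), entry by entry. *)
Definition shift_orthonormal := forall l l' p q k, Lam k ->
  shift_gram l l' p q k = [&& k == 0, l == l' & p == q]%:R.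

Lemma shift_orthonormalP : shift_orthonormal <->
  forall l l' u u', Gam u -> Gam u' ->
  ip (dilate u (psi l)) (dilate u' (psi l')) = ((u == u') && (l == l'))%:R.
Proof.
split=> [H l l' u u' Gu Gu'|H l l' p q k Lk].
  have [p [k Lk <-]] := crystal_pairP htriple Gu.
  have [q [k' Lk' <-]] := crystal_pairP htriple Gu'.
  rewrite ip_dilate_pair// H; last exact: sLam.2.
  congr (_%:R); rewrite xpair_eqE (inj_eq (sct_inj htriple)) subr_eq0 [k' == k]eq_sym.
  by case: (p == q); case: (k == k'); case: (l == l').
have L0 := sLam.1.
have := ip_dilate_pair l l' p q L0 Lk; rewrite subr0 => <-.
rewrite H; try exact: (crystal_pair htriple).
congr (_%:R); rewrite xpair_eqE (inj_eq (sct_inj htriple)) [0 == k]eq_sym.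
by case: (p == q); case: (k == 0); case: (l == l').
Qed.

Lemma conjtrE n1 n2 (M : 'M[R[i]]_(n1, n2)) (p : 'I_n2) (q : 'I_n1) :
  (M^t*) p q = conjc (M q p).
Proof. by rewrite !mxE. Qed.

Lemma coef_identityP :
  (forall (v : 'cV[R]_d) (i j : 'I_m), Lam v ->
       m%:R^-1 *: \sum_(k \in Lam) (ct i k *m (ct j (k - a *m v))^t*) =
       ((v == 0) && (i == j))%:R%:M :> 'M[R[i]]_r.+1) <-> shift_orthonormal.
Proof.
have E (v : 'cV[R]_d) (i j : 'I_m) p q : Lam v ->
    (m%:R^-1 *: \sum_(k \in Lam) (ct i k *m (ct j (k - a *m v))^t*)) p q =
    shift_gram i j p q v.
  move=> Lv; rewrite mxE fsbig_mxE.
    congr (_ * _); rewrite -exchange_fsbig_seq.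
      apply: eq_fsbigr => k _; rewrite mxE; apply: eq_bigr => s _.
      by rewrite conjtrE.
    move=> s _; apply: sub_finite_set (fct i p s) => k [Lk /=].
    by rewrite mulf_eq0 negb_or => /andP[].
  move=> p' q'; have := @finsupp_sum _ _ Lam _ (index_enum 'I_r.+1)
    (fun s k => ct i k p' s * conjc (ct j (k - a *m v) q' s)) _.
  rewrite (_ : (fun k => _) = (fun k => (ct i k *m (ct j (k - a *m v))^t*) p' q')).
    apply=> s _; apply: sub_finite_set (fct i p' s) => k [Lk /=].
    by rewrite mulf_eq0 negb_or => /andP[].
  by apply/funext => k; rewrite [RHS]mxE; apply: eq_bigr => s _; rewrite conjtrE.
split=> [H i j p q v Lv|H v i j Lv].
  rewrite -E// H// mxE.
  by case: (v == 0); case: (i == j); case: (p == q).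
apply/matrixP => p q; rewrite E// H// mxE.
by case: (v == 0); case: (i == j); case: (p == q).
Qed.

Lemma coset_split k : Lam k -> exists h, exists2 i, Lam i & a *m i + dig h = k.
Proof.
move=> /hdig.2[h [[i Li e] _]]; exists h, i => //.
by rewrite e subrK.
Qed.

Lemma fsbig_cosets (F : 'cV[R]_d -> R[i]) : finsupp_on Lam F ->
  \sum_(k \in Lam) F k = \sum_h \sum_(k \in Lam) F (a *m k + dig h).
Proof.
have inj_a k k' : a *m k = a *m k' -> k = k'.
  by move=> /(congr1 (mulmx (invmx a))); rewrite !mulKmx.
have La h k : Lam k -> Lam (a *m k + dig h).
  by move=> Lk; apply: (lattice_add htriple); [exact: Lmul|exact: hdig.1].
move=> fF; apply: (@fsbig_partition _ _ _ _ Lam Lam (fun h k => a *m k + dig h)).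
- exact: La.
- move=> h h' k k' Lk Lk' e.
  have hh' : h = h'.
    apply: (coset_reps_inj sLam hdig); exists (k' - k); first exact: sLam.2.
    have -> : dig h = a *m k' + dig h' - a *m k by rewrite -e addrAC subrr add0r.
    by rewrite mulmxBr addrAC addrK.
  by split=> //; apply: inj_a; move: e; rewrite hh' => /addIr.
- exact: coset_split.
- move=> h; apply: finsupp_bij fF; last exact: La.
  by move=> k k' _ _ /addIr/inj_a.
Qed.

Definition digit_coef l h p j k := ct l (a *m k + dig h) p j.

Lemma finsupp_digit_coef l h p j : finsupp_on Lam (digit_coef l h p j).
Proof.
apply: finsupp_bij (fct l p j).
  by move=> k k' _ _ /addIr /(congr1 (mulmx (invmx a))); rewrite !mulKmx.
by move=> k Lk; apply: (lattice_add htriple); [exact: Lmul|exact: hdig.1].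
Qed.

Lemma polyphase_entry l h p j omega :
  polyphase g Lam a m (c l) (dig h) omega p j =
  (Num.sqrt m%:R)^-1%:C * \sum_(k \in Lam) expchar k omega * digit_coef l h p j k.
Proof.
rewrite mxE fsbig_mxE; first by congr (_ * _); apply: eq_fsbigr => k _; rewrite mxE.
move=> p' q'; apply: sub_finite_set (finsupp_digit_coef l h p' q') => k [Lk /=].
by rewrite mxE mulf_eq0 negb_or => /andP[].
Qed.

Let sqrt2 : (Num.sqrt m%:R)^-1%:C * conjc ((Num.sqrt m%:R)^-1%:C : R[i]) = m%:R^-1.
Proof.
by rewrite conjc_real -rmorphM -invfM -expr2 sqr_sqrtr// fmorphV rmorph_nat.
Qed.

Lemma polyphase_mul l l' h p q j j' omega :
  polyphase g Lam a m (c l) (dig h) omega p j *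
  conjc (polyphase g Lam a m (c l') (dig h) omega q j') =
  m%:R^-1 * \sum_(v \in Lam) expchar v omega *
    correlation Lam (digit_coef l h p j) (digit_coef l' h q j') v.
Proof.
rewrite !polyphase_entry -(trig_mul_conj _ sLam);
  [|exact: finsupp_digit_coef|exact: finsupp_digit_coef].
by rewrite -sqrt2 rmorphM; ring.
Qed.

(** The lattice is the disjoint union of the cosets of its image under [a]; a shift by
    [a v] becomes a shift by [v] on each coset. *)
Lemma shift_gram_cosets l l' p q v : Lam v -> shift_gram l l' p q v =
  m%:R^-1 * \sum_(t : 'I_r.+1 * 'I_m)
    correlation Lam (digit_coef l t.2 p t.1) (digit_coef l' t.2 q t.1) v.
Proof.
move=> Lv; congr (_ * _).
rewrite -(pair_bigA _ (fun j h =>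
  correlation Lam (digit_coef l h p j) (digit_coef l' h q j) v)) /=.
apply: eq_bigr => j _; rewrite fsbig_cosets; last first.
  apply: sub_finite_set (fct l p j) => k [Lk /=].
  by rewrite mulf_eq0 negb_or => /andP[].
apply: eq_bigr => h _; apply: eq_fsbigr => k _; congr (_ * conjc _).
by rewrite /digit_coef mulmxBr addrAC.
Qed.

Lemma finsupp_shift_gram l l' p q : finsupp_on Lam (shift_gram l l' p q).
Proof.
have := @finsupp_sum _ _ Lam _ (index_enum ('I_r.+1 * 'I_m)%type)
  (fun t v => correlation Lam (digit_coef l t.2 p t.1) (digit_coef l' t.2 q t.1) v) _.
move=> /(_ _)/wrap[].
  by move=> t _; apply: finsupp_correlation => //; exact: finsupp_digit_coef.
apply: sub_finite_set => v [Lv /=]; rewrite shift_gram_cosets// mulf_eq0 negb_or.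
by move=> /andP[].
Qed.

(** The Fourier coefficients of the entries of [U U^*] are the shifted Gram matrices. *)
Lemma polyphase_gram l l' p q omega :
  (\sum_h polyphase g Lam a m (c l) (dig h) omega *m
    (polyphase g Lam a m (c l') (dig h) omega)^t*) p q =
  \sum_(v \in Lam) expchar v omega * shift_gram l l' p q v.
Proof.
transitivity (\sum_(t : 'I_r.+1 * 'I_m) \sum_(v \in Lam) expchar v omega * (m%:R^-1 *
    correlation Lam (digit_coef l t.2 p t.1) (digit_coef l' t.2 q t.1) v)).
  rewrite summxE -(pair_bigA _ (fun j h => \sum_(v \in Lam) expchar v omega * (m%:R^-1 *
    correlation Lam (digit_coef l h p j) (digit_coef l' h q j) v))) /= exchange_big.
  apply: eq_bigr => h _; rewrite mxE; apply: eq_bigr => j _.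
  rewrite conjtrE polyphase_mul mulr_fsumr.
  by apply: eq_fsbigr => v _; rewrite mulrCA.
rewrite -exchange_fsbig_seq.
  apply: eq_fsbigr => v /set_mem Lv.
  by rewrite shift_gram_cosets// !mulr_sumr.
move=> t _; apply: sub_finite_set
  (finsupp_correlation sLam (finsupp_digit_coef l t.2 p t.1)
    (finsupp_digit_coef l' t.2 q t.1)) => v [Lv /=].
by rewrite !mulf_eq0 !negb_or => /andP[_ /andP[]].
Qed.

End gram.

(** * The two unitarity conditions *)

Section equivalences.
Context {R : realType} (d r m : nat) (Gam : set (aff R d)) (g : 'I_r.+1 -> 'M[R]_d)
  (Lam : set 'cV[R]_d) (htriple : splitting_crystal_triple Gam g Lam)
  (a : 'M[R]_d) (hadm : admissible Gam a) (hm : m%:R = `|\det a|)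
  (dig : 'I_m -> 'cV[R]_d) (hdig : coset_reps Lam a dig)
  (rho : 'I_m -> 'cV[R]_d) (hrho : coset_reps (dual_lattice Lam) a^T rho)
  (V : int -> set ('cV[R]_d -> R[i])) (phi : 'cV[R]_d -> R[i])
  (hMRA : is_MRA Gam a V (fun _ : 'I_1 => phi))
  (psi : 'I_m -> 'cV[R]_d -> R[i]) (hpsi : forall l : 'I_m, V 1 (psi l))
  (c : 'I_m -> aff R d -> R[i])
  (hc : forall l : 'I_m, refinable a Gam phi (c l) (psi l)).
Local Notation leb := (@lebesgue_cV R d).
Implicit Types (u : aff R d) (k v : 'cV[R]_d) (l h : 'I_m) (p q j : 'I_r.+1).

Let a_unit := admissible_unit hadm.
Let sLam := lattice_subgroup htriple.
Local Notation U := (Ublock g Lam a dig c).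
Local Notation M := (Mblock g Lam a rho c).
Local Notation shift_orth := (shift_orthonormal g Lam a c).
Let gram := polyphase_gram htriple hadm hdig hc.

Lemma shift_orthonormal_Ublock : shift_orth -> forall omega, U omega \is unitarymx.
Proof.
move=> H omega; apply/mxblock_unitaryP => l l'; apply/matrixP => p q.
rewrite gram mxE (@fsbig_cover _ _ Lam _ [fset 0]%fset).
- rewrite big_seq_fset1 expchar0 mul1r H; last exact: sLam.1.
  by rewrite eqxx; case: (l == l'); case: (p == q).
- by move=> k /=; rewrite inE => /eqP ->; exact: sLam.1.
- by move=> k Lk; rewrite inE => /negbTE k0; rewrite H// k0 mulr0.
Qed.

(** A trigonometric polynomial that is constant almost everywhere has only a constant
    Fourier coefficient. *)
Lemma Ublock_shift_orthonormal :
  {ae leb, forall omega, U omega \is unitarymx} -> shift_orth.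
Proof.
move=> aeU l l' p q k Lk.
have fs := finsupp_shift_gram htriple hadm hdig hc l l' p q.
rewrite (@fsbig_trig_ae_cst R d Lam _ ((l == l') && (p == q))%:R sLam.1 fs _ k Lk).
  by case: (k == 0); rewrite ?mul1r ?mul0r.
apply: filterS aeU => omega uU.
have /matrixP /(_ p q) := (mxblock_unitaryP
  (fun l h => polyphase g Lam a m (c l) (dig h) omega)).1 uU l l'.
by rewrite gram mxE => ->; case: (l == l'); case: (p == q).
Qed.

(** The matrix of the characters of the dual quotient at the digits; it turns the
    polyphase matrix into the modulation matrix. *)
Definition Wblock (omega : 'cV[R]_d) : 'M[R[i]]_(\sum_(i < m) r.+1) :=
  \mxblock_(h < m, j < m)
    (((Num.sqrt m%:R)^-1%:C * expchar (dig h) (omega + invmx a^T *m rho j))%:M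
      : 'M[R[i]]_r.+1).

Let sqrt2 : (Num.sqrt m%:R)^-1%:C * (Num.sqrt m%:R)^-1%:C = m%:R^-1 :> R[i].
Proof.
by rewrite -rmorphM -invfM -expr2 sqr_sqrtr// fmorphV rmorph_nat.
Qed.

(** The entries of [W W^*] are character sums over the dual quotient, evaluated at the
    differences of digits. *)
Lemma Wblock_unitary omega : Wblock omega \is unitarymx.
Proof.
have m0 : m%:R != 0 :> R[i] by rewrite pnatr_eq0 -lt0n (index_gt0 hadm hm).
apply/mxblock_unitaryP => h h'.
have -> : \sum_(j < m) (((Num.sqrt m%:R)^-1%:C *
      expchar (dig h) (omega + invmx a^T *m rho j))%:M : 'M[R[i]]_r.+1) *m
    (((Num.sqrt m%:R)^-1%:C * expchar (dig h') (omega + invmx a^T *m rho j))%:M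
      : 'M[R[i]]_r.+1)^t* =
    (m%:R^-1 * (expchar (dig h - dig h') omega *
      \sum_j expchar (invmx a *m (dig h - dig h')) (rho j)))%:M.
  rewrite mulr_sumr mulr_sumr raddf_sum; apply: eq_bigr => j _.
  rewrite tr_scalar_mx map_scalar_mx /= -scalar_mxM; congr (_%:M).
  have cs (z : R[i]) : Num.conj ((Num.sqrt m%:R)^-1%:C * z) =
      (Num.sqrt m%:R)^-1%:C * conjc z.
    by rewrite rmorphM; congr (_ * _); exact: conjc_real.
  rewrite cs -sqrt2 expchar_mulmx trmx_inv mulrCA -expcharDr expcharDl expcharN.
  ring.
case: eqVneq => [<-|hh'].
  rewrite subrr mulmx0 expchar0 mul1r; under eq_bigr do rewrite expchar0.
  by rewrite sumr_const card_ord mulVf.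
rewrite (sum_expchar_dual (sct_lattice htriple) hrho) ?mulr0//.
  rewrite mulKVmx//; apply: sLam.2; exact: hdig.1.
move=> Ld; move/eqP: hh'; apply; apply: (coset_reps_inj sLam hdig).
by exists (invmx a *m (dig h - dig h')) => //; rewrite mulKVmx.
Qed.

Lemma refinement_mask_entry l omega p q :
  refinement_mask g Lam a m (c l) omega p q =
  m%:R^-1 * \sum_(k \in Lam) expchar k omega * ctilde g a (c l) k p q.
Proof.
rewrite mxE fsbig_mxE; first by congr (_ * _); apply: eq_fsbigr => k _; rewrite mxE.
move=> p' q'.
apply: sub_finite_set (finsupp_ctilde htriple hadm p' q' (hc l).1) => k [Lk /=].
by rewrite mxE mulf_eq0 negb_or => /andP[].
Qed.

(** The sum over the lattice is split along the cosets of the digits; on each coset the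
    characters of [a k] do not see the dual vectors [rho j]. *)
Lemma Mblock_factor omega : M omega = U (a^T *m omega) *m Wblock omega.
Proof.
rewrite /Mblock /Ublock /Wblock mul_mxblock; apply: eq_mxblock => l j.
apply/matrixP => p q; rewrite refinement_mask_entry summxE.
rewrite (fsbig_cosets htriple hadm hdig); last first.
  apply: sub_finite_set (finsupp_ctilde htriple hadm p q (hc l).1) => k [Lk /=].
  by rewrite mulf_eq0 negb_or => /andP[].
rewrite mulr_sumr; apply: eq_bigr => h _.
rewrite mul_mx_scalar mxE (polyphase_entry htriple hadm hdig hc).
have -> : \sum_(k \in Lam) expchar (a *m k + dig h) (omega + invmx a^T *m rho j) *
      ctilde g a (c l) (a *m k + dig h) p q =
    expchar (dig h) (omega + invmx a^T *m rho j) *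
    \sum_(k \in Lam) expchar k (a^T *m omega) * digit_coef g a dig c l h p q k.
  rewrite mulr_fsumr; apply: eq_fsbigr => k /set_mem Lk.
  rewrite expcharDl expchar_mulmx mulmxDr mulKVmx ?unitmx_tr// (expcharDr k).
  by rewrite (expchar_int (hrho.1 j _ Lk)) /digit_coef; ring.
by rewrite -sqrt2; ring.
Qed.

Lemma Mblock_unitary omega :
  (M omega \is unitarymx) = (U (a^T *m omega) \is unitarymx).
Proof.
apply/idP/idP => [uM|uU]; last first.
  rewrite Mblock_factor; exact: mul_unitarymx uU (Wblock_unitary omega).
have -> : U (a^T *m omega) = M omega *m (Wblock omega)^t*.
  rewrite Mblock_factor -mulmxA; have /unitarymxP -> := Wblock_unitary omega.
  by rewrite mulmx1.
apply: mul_unitarymx uM _; rewrite trmxC_unitary; exact: Wblock_unitary.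
Qed.

(** The modulation matrix at [omega] is governed by the polyphase matrix at
    [a^T omega], so the exceptional null set is transported by an invertible matrix. *)
Lemma Mblock_shift_orthonormal :
  {ae leb, forall omega, M omega \is unitarymx} -> shift_orth.
Proof.
move=> aeM; apply: Ublock_shift_orthonormal.
have uaT : invmx a^T \in unitmx by rewrite unitmx_inv unitmx_tr.
have := ae_affine_cV 0 uaT aeM.
apply: filterS => omega; rewrite Mblock_unitary addr0 mulKVmx//.
by rewrite unitmx_tr.
Qed.

(** The columns of a unitary polyphase matrix have norm one; reading this off the
    constant Fourier coefficients gives Parseval's identity for the expansion of
    each vector of the basis of [V 1] in the dilates of the [psi l]. *)
Lemma shift_orthonormal_columns : shift_orth -> forall h j,
  \sum_(t : 'I_r.+1 * 'I_m) m%:R^-1 * \sum_(k \in Lam)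
    digit_coef g a dig c t.2 h t.1 j k * conjc (digit_coef g a dig c t.2 h t.1 j k) = 1.
Proof.
move=> H h j.
pose D (t : 'I_r.+1 * 'I_m) := digit_coef g a dig c t.2 h t.1 j.
pose C v := \sum_(t : 'I_r.+1 * 'I_m) m%:R^-1 * correlation Lam (D t) (D t) v.
have fD t : finsupp_on Lam (D t) by exact: (finsupp_digit_coef htriple hadm hdig hc).
have fCt t : finsupp_on Lam (fun v => m%:R^-1 * correlation Lam (D t) (D t) v).
  apply: sub_finite_set (finsupp_correlation sLam (fD t) (fD t)) => v [Lv /=].
  by rewrite mulf_eq0 negb_or => /andP[].
have fC : finsupp_on Lam C by apply: finsupp_sum => t _.
have C0 : C 0 = 1.
  rewrite (@fsbig_trig_ae_cst R d Lam C 1 sLam.1 fC _ 0 sLam.1) ?eqxx ?mulr1//.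
  apply: aeW => omega.
  have := @mxblock_unitary_adjoint R r m
    (fun l h => polyphase g Lam a m (c l) (dig h) omega)
    (shift_orthonormal_Ublock H omega) h h.
  move=> /matrixP /(_ j j); rewrite mxE !eqxx summxE => E.
  rewrite -[RHS]/((true%:R : R[i]) *+ true) -E.
  transitivity (\sum_(v \in Lam) \sum_(t : 'I_r.+1 * 'I_m)
      expchar v omega * (m%:R^-1 * correlation Lam (D t) (D t) v)).
    by apply: eq_fsbigr => v _; rewrite mulr_sumr.
  rewrite exchange_fsbig_seq; last first.
    move=> t _; apply: sub_finite_set (fCt t) => v [Lv /=].
    by rewrite mulf_eq0 negb_or => /andP[].
  rewrite -(pair_bigA _ (fun p l => \sum_(v \in Lam) expchar v omega *
    (m%:R^-1 * correlation Lam (D (p, l)) (D (p, l)) v))) /= exchange_big /=.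
  apply: eq_bigr => l _; rewrite mxE; apply: eq_bigr => p _.
  rewrite conjtrE mulrC (polyphase_mul htriple hadm hdig hc) mulr_fsumr.
  by apply: eq_fsbigr => v _; rewrite mulrCA.
rewrite -[RHS]C0; apply: eq_bigr => t _; congr (_ * _).
by apply: eq_fsbigr => k _; rewrite subr0.
Qed.

End equivalences.

(** * Completeness *)

Section completeness.
Context {R : realType} (d r m : nat) (Gam : set (aff R d)) (g : 'I_r.+1 -> 'M[R]_d)
  (Lam : set 'cV[R]_d) (htriple : splitting_crystal_triple Gam g Lam)
  (a : 'M[R]_d) (hadm : admissible Gam a) (hm : m%:R = `|\det a|)
  (dig : 'I_m -> 'cV[R]_d) (hdig : coset_reps Lam a dig)
  (V : int -> set ('cV[R]_d -> R[i])) (phi : 'cV[R]_d -> R[i])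
  (hMRA : is_MRA Gam a V (fun _ : 'I_1 => phi))
  (psi : 'I_m -> 'cV[R]_d -> R[i]) (hpsi : forall l : 'I_m, V 1 (psi l))
  (c : 'I_m -> aff R d -> R[i])
  (hc : forall l : 'I_m, refinable a Gam phi (c l) (psi l)).
Local Notation leb := (@lebesgue_cV R d).
Local Notation fn := ('cV[R]_d -> R[i]).
Implicit Types (u : aff R d) (k v : 'cV[R]_d) (l h : 'I_m) (p q j : 'I_r.+1).

Let sLam := lattice_subgroup htriple.
Local Notation shift_orth := (shift_orthonormal g Lam a c).
Local Notation D := [set p : 'M[R]_d * 'cV[R]_d * 'I_m | Gam p.1].
Local Notation dpsi := (fun p : 'M[R]_d * 'cV[R]_d * 'I_m => dilate p.1 (psi p.2)).

Lemma shift_orthonormal_family : shift_orth -> orthonormal_family D dpsi.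
Proof.
move=> /(shift_orthonormalP htriple hadm hm hMRA hpsi hc) H [u l] [u' l'] Gu Gu'.
by rewrite H// xpair_eqE.
Qed.

Lemma L2_dpsi (p : 'M[R]_d * 'cV[R]_d * 'I_m) : D p -> L2 (dpsi p).
Proof. by move=> Gp; apply: (L2_dilate_psi htriple hMRA (hpsi p.2)). Qed.

(** Parseval's identity holds with finitely many terms: the coefficients of the basis
    vector [(g j, a w + dig h)] on the dilates of the [psi l] are, up to order and
    conjugation, the coefficients of column [(h, j)] of the polyphase matrix. *)
Lemma dbasis_in_span u : shift_orth -> Gam u ->
  L2closure (lin_span D dpsi) (dbasis a phi u).
Proof.
move=> H Gu.
have [j [k0 Lk0 uE]] := crystal_pairP htriple Gu.
have [h [w Lw k0E]] := coset_split hdig Lk0.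
pose F (p : 'M[R]_d * 'cV[R]_d * 'I_m) :=
  ip (dbasis a phi u) (dpsi p) * conjc (ip (dbasis a phi u) (dpsi p)).
pose dc (t : 'I_r.+1 * 'I_m) := digit_coef g a dig c t.2 h t.1 j.
have FE (t : 'I_r.+1 * 'I_m) v : Lam v ->
    F ((g t.1, v), t.2) = m%:R^-1 * (dc t (w - v) * conjc (dc t (w - v))).
  move=> Lv; have Gp := crystal_pair htriple t.1 Lv.
  have E : ip (dbasis a phi u) (dpsi ((g t.1, v), t.2)) =
      conjc (dc t (w - v) / (Num.sqrt m%:R)%:C).
    rewrite ip_conj; [|exact: (L2_dbasis htriple hadm hMRA)|exact: L2_dpsi].
    rewrite (ip_dilate_psi_dbasis htriple hadm hm hMRA (hpsi _) (hc _) Gp Gu).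
    congr (conjc (_ / _)).
    by rewrite /dcoef -uE -(ctildeE htriple) -k0E /dc /digit_coef mulmxBr addrAC.
  rewrite /F E conjcK; move: (dc t (w - v)) => z.
  have -> : m%:R^-1 = (Num.sqrt m%:R)%:C^-1 * conjc (Num.sqrt m%:R)%:C^-1 :> R[i].
    by rewrite conjc_inv conjc_real -invfM -rmorphM -expr2 sqr_sqrtr// rmorph_nat.
  have -> y : conjc (z / y) = conjc z * conjc y^-1 by rewrite rmorphM.
  by ring.
pose f (t : 'I_r.+1 * 'I_m) v : 'M[R]_d * 'cV[R]_d * 'I_m := ((g t.1, v), t.2).
have fD t v : Lam v -> D (f t v) by move=> Lv; exact: (crystal_pair htriple).
have f_onto (p : 'M[R]_d * 'cV[R]_d * 'I_m) : D p -> exists t, exists2 v, Lam v & f t v = p.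
  case: p => u' l /= Gu'; have [q [v Lv <-]] := crystal_pairP htriple Gu'.
  by exists (q, l), v.
have fs t : finsupp_on Lam (F \o f t).
  have := finsupp_shift sLam Lw (finsupp_digit_coef htriple hadm hdig hc t.2 h t.1 j).
  apply: sub_finite_set => v [Lv /=]; rewrite FE// !mulf_eq0 !negb_or.
  by move=> /andP[_ /andP[]].
have [A AD FA] := finsupp_cover (finsupp_partition f_onto fs).
apply: (parseval_span L2_dpsi (shift_orthonormal_family H) AD).
  exact: (L2_dbasis htriple hadm hMRA).
rewrite (ip_dbasis htriple hadm hMRA)// eqxx.
rewrite -(fsbig_cover AD FA) (@fsbig_partition _ _ _ _ Lam D f F fD _ f_onto fs); last first.
  by move=> [q l] [q' l'] v v' _ _ [/(sct_inj htriple) -> -> ->].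
rewrite -[LHS](shift_orthonormal_columns htriple hadm hdig hc H h j).
apply: eq_bigr => t _; rewrite mulr_fsumr.
rewrite (reindex_fsbig (fun v => w - v) Lam); last first.
  split=> [v Lv|v v' _ _ /addrI/oppr_inj //|v Lv]; first exact: sLam.2.
  by exists (w - v); [exact: sLam.2|rewrite subKr].
by apply: eq_fsbigr => v /set_mem Lv; rewrite FE.
Qed.

(** Membership in [VV1] is automatic: the coefficient matrices of [Psi] are those
    read off the refinement equation, which are symmetric. *)
Lemma Psi_VV1 l : VV1 g Lam a (V 1) phi (Psi g (psi l)).
Proof.
have Gi i := crystal_point htriple i.
split=> [i|]; first exact: (V1_dilate_psi htriple hadm hm hMRA (hpsi l) (hc l) (Gi i)).
exists (ctilde g a (c l)); first exact: (ctilde_symmetry htriple hadm).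
move=> i eps eps0.
have [A [AG cA e]] := dilate_refinable htriple hadm hm (hc l) (Gi i).
have [A0 A0L cA0] := @finsupp_cover_seq _ _ Lam _ (index_enum 'I_r.+1)
  (fun j k => ctilde g a (c l) k i j)
  (fun j _ => finsupp_ctilde htriple hadm i j (hc l).1).
exists A0 => // B BL A0B.
pose h : fn := fun x =>
  \sum_(k <- B) \sum_j ctilde g a (c l) k i j * Phi g phi j (a *m x - k).
rewrite -/(L2norm (fun x => Psi g (psi l) i x - h x)).
have sm0 : (Num.sqrt m%:R)%:C != 0 :> R[i].
  by rewrite fmorph_eq0 gt_eqF// sqrtr_gt0 ltr0n (index_gt0 hadm hm).
have hE : h = fun x => \sum_(v <- A)
    (dcoef a (c l) (linear_aff (g i)) v / (Num.sqrt m%:R)%:C) * dbasis a phi v x.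
  apply/funext => x.
  transitivity (\sum_(v \in Gam) dcoef a (c l) (linear_aff (g i)) v *
      phi (aff_app (aff_inv v) (a *m x))); last first.
    rewrite (fsbig_cover AG); last by move=> v Gv vA; rewrite cA// mul0r.
    apply: eq_big_seq => v /AG Gv.
    by rewrite (dbasis_app htriple hadm hm)// mulrA divfK.
  rewrite (fsbig_crystal htriple); last first.
    apply: sub_finite_set (finsupp_dcoef htriple hadm (hc l) (Gi i)) => v [Gv /=].
    by rewrite mulf_eq0 negb_or => /andP[].
  rewrite /h exchange_big; apply: eq_bigr => j _.
  have cE k : dcoef a (c l) (linear_aff (g i)) (g j, k) = ctilde g a (c l) k i j.
    by rewrite /dcoef -(ctildeE htriple) mulmx0 subr0.
  rewrite (fsbig_cover BL); last first.
    move=> k Lk kB; rewrite cE (cA0 j)// ?mul0r ?mem_index_enum//.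
    by apply: contra kB => kA0; apply: A0B.
  apply: eq_bigr => k _; rewrite cE; congr (_ * phi _).
  by rewrite /aff_app /= mulmxBr.
have P2 : L2 (Psi g (psi l) i) by exact: (L2_dilate_psi htriple hMRA (hpsi l) (Gi i)).
have h2 : L2 h.
  by rewrite hE; apply: L2_sum => v /AG; exact: (L2_dbasis htriple hadm hMRA).
have z2 := @L2_0 R d.
suff -> : L2norm (fun x => Psi g (psi l) i x - h x) = 0 by [].
have ae0 : {ae leb, forall x, Psi g (psi l) i x - h x = 0}.
  by apply: filterS e => x ex; rewrite hE -ex subrr.
rewrite /L2norm (@ip_ae _ _ _ (fun=> 0) _ (fun=> 0))//; try exact: L2_sub.
by rewrite ip0l// sqrtr0.
Qed.

End completeness.

(** * The equivalence *)

Theorem theorem4p5 (R : realType) (d r m : nat)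
    (Gam : set (aff R d)) (g : 'I_r.+1 -> 'M[R]_d) (Lam : set 'cV[R]_d)
    (htriple : splitting_crystal_triple Gam g Lam)
    (a : 'M[R]_d) (hadm : admissible Gam a) (hm : m%:R = `|\det a|)
    (dig : 'I_m -> 'cV[R]_d) (hdig : tiling_digits Lam a dig)
    (rho : 'I_m -> 'cV[R]_d) (hrho : coset_reps (dual_lattice Lam) a^T rho)
    (V : int -> set ('cV[R]_d -> R[i])) (phi : 'cV[R]_d -> R[i])
    (hMRA : is_MRA Gam a V (fun _ : 'I_1 => phi))
    (psi : 'I_m -> 'cV[R]_d -> R[i])
    (hpsi0 : forall l : 'I_m, l = 0%N :> nat -> psi l = phi)
    (hpsi : forall l : 'I_m, V 1 (psi l))
    (c : 'I_m -> aff R d -> R[i])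
    (hc : forall l : 'I_m, refinable a Gam phi (c l) (psi l)) :
  [<->
    (* (a) *)
    orthonormal_basis
      [set p : 'M[R]_d * 'cV[R]_d * 'I_m | Gam p.1 /\ p.2 != 0%N :> nat]
      (fun p => dilate p.1 (psi p.2)) (orthocomplement (V 1) (V 0)) ;
    (* (b) *)
    {ae @lebesgue_cV R d, forall omega,
       Ublock g Lam a dig c omega \is unitarymx} /\
    (forall l : 'I_m, VV1 g Lam a (V 1) phi (Psi g (psi l))) ;
    (* (c) *)
    {ae @lebesgue_cV R d, forall omega,
       Mblock g Lam a rho c omega \is unitarymx} /\
    (forall l : 'I_m, VV1 g Lam a (V 1) phi (Psi g (psi l))) ;
    (* (d) *)
    (forall (v : 'cV[R]_d) (i j : 'I_m), Lam v ->
       m%:R^-1 *: \sum_(k \in Lam)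
         (ctilde g a (c i) k *m (ctilde g a (c j) (k - a *m v))^t*) =
       ((v == 0) && (i == j))%:R%:M) /\
    (forall i : 'I_m, crystal_symmetry g Lam a (ctilde g a (c i))) ].
Proof.
have [hreps _] := hdig.
have orthP := shift_orthonormalP htriple hadm hm hMRA hpsi hc.
have inV := Psi_VV1 htriple hadm hm hMRA hpsi hc.
have V01 : V 0 `<=` V 1 by have := mra_incr hMRA (j := 0); rewrite add0r.
have dpsi2 := L2_dpsi htriple hMRA hpsi.
tfae.
- move=> [_ onb spW]; split; last exact: inV.
  apply: aeW; apply: (shift_orthonormal_Ublock htriple hadm hreps hc).
  apply/orthP => l l' u u' Gu Gu'.
  have inW u1 (l1 : 'I_m) : Gam u1 -> l1 != 0%N :> nat ->
      orthocomplement (V 1) (V 0) (dilate u1 (psi l1)).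
    move=> Gu1 l1n; rewrite -spW; apply: sub_L2closure; last first.
      exact: (@mem_lin_span R d _ _ (fun p => dilate p.1 (psi p.2)) (u1, l1)).
    have [+ _ _] := @lin_span_subspace R d _
      [set p : 'M[R]_d * 'cV[R]_d * 'I_m | Gam p.1 /\ p.2 != 0%N :> nat]
      (fun p => dilate p.1 (psi p.2)) (fun p Dp => dpsi2 p Dp.1).
    exact.
  have inV0 u1 (l1 : 'I_m) : Gam u1 -> l1 = 0%N :> nat -> V 0 (dilate u1 (psi l1)).
    by move=> Gu1 l10; rewrite hpsi0//; exact: (V0_dilate_phi hMRA).
  have [l0|ln] := eqVneq (l : nat) 0%N; have [l'0|l'n] := eqVneq (l' : nat) 0%N.
  + rewrite !hpsi0// (ip_dilate_phi hMRA)//.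
    have -> : l == l' by rewrite -val_eqE /= l0 l'0.
    by rewrite andbT.
  + have -> : (l == l') = false.
      by apply/negbTE; rewrite -val_eqE /= l0 eq_sym.
    rewrite andbF ip_conj; [|exact: (dpsi2 (u, l))|exact: (dpsi2 (u', l'))].
    by rewrite (inW _ _ Gu' l'n).2 ?rmorph0//; exact: inV0.
  + have -> : (l == l') = false by apply/negbTE; rewrite -val_eqE /= l'0.
    by rewrite andbF (inW _ _ Gu ln).2//; exact: inV0.
  + by rewrite (onb (u, l) (u', l'))// xpair_eqE.
- move=> [uU _]; split; last exact: inV.
  apply: aeW => omega.
  rewrite (Mblock_unitary htriple hadm hm hreps hrho hc).
  apply: (shift_orthonormal_Ublock htriple hadm hreps hc).
  exact: (Ublock_shift_orthonormal htriple hadm hreps hc uU).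
- move=> [uM _]; split; last by move=> i; exact: (ctilde_symmetry htriple hadm).
  apply/(coef_identityP htriple hadm hc).
  exact: (Mblock_shift_orthonormal htriple hadm hm hreps hrho hc uM).
- move=> [/(coef_identityP htriple hadm hc) H _].
  pose l0 := Ordinal (index_gt0 hadm hm).
  pose D0 := [set p : 'M[R]_d * 'cV[R]_d * 'I_m | Gam p.1 /\ p.2 = l0].
  pose D1 := [set p : 'M[R]_d * 'cV[R]_d * 'I_m | Gam p.1 /\ p.2 != 0%N :> nat].
  have D01 : D0 `|` D1 = [set p : 'M[R]_d * 'cV[R]_d * 'I_m | Gam p.1].
    apply/seteqP; split=> [p [[]|[]]//|p Gp /=].
    have [p0|p0] := eqVneq (p.2 : nat) 0%N; last by right.
    by left; split=> //; apply: val_inj.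
  have onb := shift_orthonormal_family htriple hadm hm hMRA hpsi hc H.
  have psi0 : psi l0 = phi by exact: hpsi0.
  split.
  + by move=> p [Gp _]; exact: dpsi2.
  + by move=> p q [Gp _] [Gq _]; exact: onb.
  + apply: (@orthocomplement_span _ _ _ D0 D1) => //.
    * exact: (mra_closed hMRA 1).
    * move=> p [[Gp _]|[Gp _]];
      exact: (V1_dilate_psi htriple hadm hm hMRA (hpsi p.2) (hc p.2) Gp).
    * by rewrite D01.
    * by apply/seteqP; split=> // -[u l] [[/= _ ->] [_ /=]].
    * by move=> [u l] [/= Gp ->]; rewrite psi0; exact: (V0_dilate_phi hMRA).
    * move=> k h k2 ko; apply: (V0_orthogonal hMRA) => // u Gu.
      by rewrite -psi0; apply: (ko (u, l0)).
    * rewrite D01; apply: (V1_sub_span htriple hadm hMRA) => [|u Gu].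
        by apply: L2closure_linear_subspace; apply: lin_span_subspace; exact: dpsi2.
      exact: (dbasis_in_span htriple hadm hm hreps hMRA hpsi hc).
Qed.
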